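(* Any $m\in\mathbb{N}$ can be written as $x^2+y^2+z^2+w^2$ with $x\in\mathbb{N}$ and $y,z,w\in\mathbb{N}/3$ such that $x+y+2z$ is an integer square.
   Context: $\mathbb{N}=\{0,1,2,\ldots\}$; $\mathbb{N}/3=\{k/3: k\in\mathbb{N}\}$; an integer square is an element of $\{t^2: t\in\mathbb{Z}\}$. *)

(* Defs.v *)
From mathcomp Require Import all_boot all_order all_algebra.

Set Implicit Arguments.
Unset Strict Implicit.
Unset Printing Implicit Defensive.

Import GRing.Theory.
Local Open Scope ring_scope.

Definition in_nat_thirds (q : rat) : Prop := exists k : nat, q = k%:R / 3%:R.

Definition is_int_square (q : rat) : Prop := exists t : int, q = (t ^+ 2)%:~R.

(* Main.v *)
From Stdlib Require Import ZArith.
Require Import Defs.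
From mathcomp Require Import all_boot all_order all_fingroup all_algebra.
From mathcomp Require Import cyclic finfield zify ring.

Set Implicit Arguments.
Unset Strict Implicit.
Unset Printing Implicit Defensive.

Import Order.TTheory GRing.Theory Num.Theory.
Local Open Scope ring_scope.

(** Put L = x + y + 2z, a = x - y and B = x + y - z.  The vectors (1,1,2),
    (1,-1,0) and (1,1,-1) are orthogonal, whence
      6 (x^2 + y^2 + z^2 + w^2) = L^2 + 3 a^2 + 2 B^2 + 6 w^2.
    Writing m as x^2 + y^2 + z^2 + w^2 over the integers with L = s^2 is therefore
    the same as representing n = 6m - s^4 by 2B^2 + 3a^2 + 6w^2, the congruences
    needed to recover x, y, z being automatic up to signs
    ([four_squares_on_plane]).

    Signs are where the thirds come from.  If 4m <= s^4, the point (x,y,z,w) is so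
    close to the direction (1,1,2,0) that, after exchanging x and y or changing the
    sign of w, one has x >= 0 and either (y,z) >= 0, or else the rational rotation
      (y,z,w) -> ((-y+2z+2w)/3, (2y+2z-w)/3, (2y-z+2w)/3),
    which preserves both y + 2z and y^2 + z^2 + w^2, produces nonnegative
    coordinates ([nonneg_solution]).

    To represent n, which may be freed of its factors 4, first represent 3n by
    x^2 + 2(y^2 + yz + z^2), and pass from one form to the other by a rational change of variables ([divide_out_3]).  Reduction
    theory shows that a positive ternary form of determinant 3 is equivalent to this
    form or to x^2 + y^2 + 3z^2 ([ternary_det3]), so that it suffices to exhibit one
    form of determinant 3 which represents N = 3n and is not of the second type.  As
    in the classical proof of the three squares theorem, such a form is written down
    from a number c with M | c t^2 + 1 and c | h^2 + M, where M = 3N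
    ([reciprocal_divisors]); only the classes 5 mod 8 and 0 mod 4 of N must be
    avoided.

    Finding c is usually done with a prime in an arithmetic progression.  Here c is,
    up to a factor 2, a product of primes r with chi(r) = 1, where chi is the
    Kronecker character (-M/.), periodic by quadratic reciprocity.  Up to squares
    such products fill the kernel of chi modulo its period: otherwise a second real
    character psi would be 1 at each prime where chi is 1 and -1 somewhere on the
    kernel of chi, and no prime could have psi = psi chi = -1.  But two nonprincipal
    real characters g, h do take the value -1 simultaneously at some prime
    ([two_characters_common_N1]).  If they did not, the Dirichlet convolution g * h
    would be nonnegative, and at least 1 at the squares prime to the modulus, so the
    sum of (g * h)(n) (X - n) over n <= X would be at least of order X^(3/2); yet
    partial summation in both variables bounds it by a multiple of X log X.

    Finally, a suitable s with 4m <= s^4 <= 6m exists once m is large and not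
    divisible by 16; multiples of 16 follow by scaling, and the finitely many other
    m by a computation. *)

(** * Real characters *)

Record real_character (Q : nat) (g : nat -> int) : Prop := RealCharacter {
  rcM : forall a b, g (a * b)%N = g a * g b;
  rcD : forall a, g (a + Q)%N = g a;
  rc_unit : forall a, coprime a Q -> g a = 1 \/ g a = -1;
  rc_zero : forall a, ~~ coprime a Q -> g a = 0 }.

Lemma rc1 Q g : real_character Q g -> g 1%N = 1.
Proof.
move=> rg; have := rcM rg 1 1; rewrite mul1n.
by case: (rc_unit rg (coprime1n Q)) => ->.
Qed.

Lemma rcX Q g : real_character Q g -> forall a n, g (a ^ n)%N = g a ^+ n.
Proof.
move=> rg a; elim=> [|n IHn]; first by rewrite expn0 expr0 (rc1 rg).
by rewrite expnS exprS (rcM rg) IHn.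
Qed.

Lemma rcDM Q g : real_character Q g -> forall a k, g (a + k * Q)%N = g a.
Proof.
move=> rg a; elim=> [|k IHk]; first by rewrite addn0.
by rewrite mulSn addnCA addnC (rcD rg).
Qed.

Lemma rc_eqmod Q g a b : real_character Q g -> a = b %[mod Q] -> g a = g b.
Proof.
move=> rg eab; rewrite (divn_eq a Q) (divn_eq b Q) eab.
by rewrite !(addnC (_ * Q)%N) !(rcDM rg).
Qed.

Lemma rc_norm Q g : real_character Q g -> forall a, `|g a| <= 1.
Proof.
move=> rg a; case: (boolP (coprime a Q)) => [/(rc_unit rg) [] ->|/(rc_zero rg) ->];
  by rewrite ?normrN ?normr1 ?normr0.
Qed.

Definition partial_sum (g : nat -> int) (n : nat) : int := \sum_(k < n) g k.

(** Multiplication by u permutes the residues modulo Q and changes the sign of the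
    sum. *)
Lemma rc_sum_period Q g u : (0 < Q)%N -> real_character Q g -> g u = -1 ->
  partial_sum g Q = 0.
Proof.
move=> Q0 rg gu.
have cuQ : coprime u Q by apply/negPn/negP => /(rc_zero rg); rewrite gu.
pose h (k : 'I_Q) := Ordinal (ltn_pmod (u * k) Q0).
have hinj : injective h.
  move=> i j /(congr1 val) /= /eqP eij; apply/val_inj => /=.
  wlog lij : i j eij / (i <= j)%N.
    by move=> W; case: (leqP i j) => [/W->//|/ltnW /W->//]; rewrite eq_sym.
  move: eij; rewrite eq_sym eqn_mod_dvd ?leq_mul2l ?lij ?orbT //.
  rewrite -mulnBr Gauss_dvdr; last by rewrite coprime_sym.
  by have := ltn_ord j; have := ltn_ord i; move=> ? ? /dvdnP [[|c] ?]; nia.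
have E : partial_sum g Q = - partial_sum g Q.
  rewrite {1}/partial_sum (reindex_inj hinj) /= -sumrN; apply: eq_bigr => k _.
  by rewrite (rc_eqmod rg (modn_mod _ _)) (rcM rg) gu mulN1r.
by lia.
Qed.

Lemma abel_summation (g v : nat -> int) (n : nat) :
  \sum_(k < n) g k * v k =
  partial_sum g n * v n
  + \sum_(k < n) partial_sum g k.+1 * (v k - v k.+1).
Proof.
elim: n => [|n IHn]; first by rewrite /partial_sum !big_ord0 mul0r addr0.
rewrite !big_ord_recr /= IHn /partial_sum !big_ord_recr /=.
ring.
Qed.

(** The sum over a period vanishes, so the partial sums are periodic. *)
Lemma partial_sum_bound Q g u : (0 < Q)%N -> real_character Q g -> g u = -1 ->
  forall n, `|partial_sum g n| <= Q%:Z.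
Proof.
move=> Q0 rg gu.
have shift k : partial_sum g (k + Q) = partial_sum g k.
  elim: k => [|k IHk].
    by rewrite (rc_sum_period Q0 rg gu) /partial_sum big_ord0.
  by rewrite addSn /partial_sum !big_ord_recr /= -!/(partial_sum g _) IHk (rcD rg).
have le_n n : `|partial_sum g n| <= n%:Z.
  elim: n => [|n IHn]; first by rewrite /partial_sum big_ord0 normr0.
  rewrite /partial_sum big_ord_recr /=; apply: le_trans (ler_normD _ _) _.
  by rewrite -addn1 PoszD; apply: lerD => //; apply: (rc_norm rg).
elim/ltn_ind=> n IHn; case: (leqP n Q) => [nQ|Qn].
  by apply: le_trans (le_n n) _; lia.
by rewrite -(subnK (ltnW Qn)) shift; apply: IHn; lia.
Qed.

(** After partial summation, the differences of a monotone weight telescope. *)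
Lemma monotone_sum_bound Q g u (v : nat -> nat) n :
  (0 < Q)%N -> real_character Q g -> g u = -1 ->
  (forall k, v k.+1 <= v k)%N ->
  `|\sum_(k < n) g k * (v k)%:Z| <= Q%:Z * (v 0%N)%:Z.
Proof.
move=> Q0 rg gu vmono; rewrite (abel_summation g (fun k => (v k)%:Z)).
apply: (@le_trans _ _ (Q%:Z * (v n)%:Z + \sum_(k < n) Q%:Z * ((v k)%:Z - (v k.+1)%:Z))).
  apply: le_trans (ler_normD _ _) _; apply: lerD.
    by rewrite normrM ler_pM // ?(partial_sum_bound Q0 rg gu) // ger0_norm.
  apply: le_trans (ler_norm_sum _ _ _) _; apply: ler_sum => k _.
  rewrite normrM ler_pM // ?(partial_sum_bound Q0 rg gu) // ger0_norm //.
  by have := vmono k; lia.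
rewrite -mulr_sumr -mulrDr le_eqVlt; apply/orP; left; apply/eqP.
congr (_ * _); elim: n => [|n IHn]; first by rewrite big_ord0 addr0.
by rewrite big_ord_recr /= -IHn; ring.
Qed.

(** * A prime where two real characters are both -1 *)

Definition convolution (g h : nat -> int) (n : nat) : int :=
  \sum_(d <- divisors n) g d * h (n %/ d)%N.

(** The ramp X - n, truncated at 0, replaces the sharp cut-off n <= X: with the
    latter both sides of the final comparison would have the order X^(1/2). *)
Definition weighted_row (h : nat -> int) (X d : nat) : int :=
  \sum_(e < X.+1) h e * (X - d * e)%N%:Z.

(** The weight (X - de) - (X - (d+1)e) is not monotone in e: it increases up to about
    c = X / (d+1), rounded up, and then decreases.  It is the difference of
    min(c, X - de) and c - e, which are both nonincreasing and at most c. *)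
Lemma weighted_row_diff Q h u X d :
  (0 < Q)%N -> real_character Q h -> h u = -1 -> (0 < d)%N ->
  `|weighted_row h X d - weighted_row h X d.+1|
     <= 2 * Q%:Z * ((X + d) %/ d.+1)%N%:Z.
Proof.
move=> Q0 rh hu d0; set c := ((X + d) %/ d.+1)%N.
have cle : (d.+1 * c <= X + d)%N by rewrite mulnC leq_trunc_div.
have cgt : (X <= d.+1 * c)%N.
  by have := ltn_ceil (X + d) (ltn0Sn d); rewrite -/c => ?; nia.
have -> : weighted_row h X d - weighted_row h X d.+1 =
  \sum_(e < X.+1) h e * (minn c (X - d * e))%:Z
  - \sum_(e < X.+1) h e * (c - e)%N%:Z.
  rewrite /weighted_row -!sumrB; apply: eq_bigr => -[e /= _] _.
  rewrite -!mulrBr; congr (_ * _).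
  case: (ltnP e c) => ec.
    have ? : (d.+1 * e.+1 <= d.+1 * c)%N by rewrite leq_mul2l ec orbT.
    have ? : (d * e.+1 <= d * c)%N by rewrite leq_mul2l ec orbT.
    by lia.
  have ? : (d.+1 * c <= d.+1 * e)%N by rewrite leq_mul2l ec orbT.
  have ? : (d * c <= d * e)%N by rewrite leq_mul2l ec orbT.
  by lia.
apply: le_trans (ler_normB _ _) _; rewrite -mulrA mulrDl mul1r; apply: lerD.
  apply: le_trans (monotone_sum_bound (v := fun e => minn c (X - d * e)%N) _ Q0 rh hu _) _.
    by move=> k; rewrite mulnS; lia.
  by rewrite ler_wpM2l //; lia.
apply: le_trans (monotone_sum_bound (v := fun e => (c - e)%N) _ Q0 rh hu _) _.
  by move=> k; lia.
by rewrite subn0.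
Qed.

Definition weighted_sum (g h : nat -> int) (X : nat) : int :=
  \sum_(d < X.+1) g d * weighted_row h X d.

(** Partial summation in d, the row differences being estimated by partial summation
    in e. *)
Lemma weighted_sum_bound Q g h u v X :
  (0 < Q)%N -> real_character Q g -> real_character Q h ->
  g u = -1 -> h v = -1 ->
  `|weighted_sum g h X| <=
    2 * Q%:Z ^+ 2 * (\sum_(1 <= d < X.+1) (X + d) %/ d.+1)%N%:Z.
Proof.
move=> Q0 rg rh gu hv.
have Q1 : (1 < Q)%N.
  rewrite ltn_neqAle Q0 andbT; apply/eqP => Q1; subst Q.
  have := rc_eqmod rg (_ : u = 1 %[mod 1]); rewrite !modn1 => /(_ erefl).
  by rewrite gu (rc1 rg).
have z0 f : real_character Q f -> f 0%N = 0.
  by move=> rf; apply: (rc_zero rf); rewrite /coprime gcd0n; lia.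
rewrite /weighted_sum (abel_summation g (weighted_row h X)).
have -> : weighted_row h X X.+1 = 0.
  rewrite /weighted_row big1 // => -[[|e] /= _] _; first by rewrite (z0 _ rh) mul0r.
  by rewrite (_ : X - _ = 0)%N ?mulr0 //; nia.
rewrite mulr0 add0r big_ord_recl /= {1}/partial_sum big_ord1 (z0 _ rg) mul0r add0r.
rewrite big_add1 big_mkord.
apply: le_trans (ler_norm_sum _ _ _) _.
rewrite -[(\sum_(i < _) _)%N%:Z]/(Posz _) (big_morph Posz PoszD erefl) mulr_sumr; apply: ler_sum => i _.
rewrite normrM (_ : 2 * _ * _ = Q%:Z * (2 * Q%:Z * ((X + i.+1) %/ i.+2)%N%:Z)); last by ring.
by rewrite ler_pM // ?(partial_sum_bound Q0 rg gu) // (weighted_row_diff _ Q0 rh hv).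
Qed.

Lemma perm_divisors n N : (0 < n < N)%N ->
  perm_eq [seq d <- index_iota 0 N | (d %| n)%N] (divisors n).
Proof.
case/andP=> n0 nN; apply: uniq_perm; rewrite ?filter_uniq ?iota_uniq ?divisors_uniq //.
move=> d; rewrite mem_filter mem_index_iota -dvdn_divisors //.
case: (boolP (d %| n)%N) => //= dn; have := dvdn_leq n0 dn; lia.
Qed.

Lemma weighted_rowE (h : nat -> int) X d : h 0%N = 0 -> (0 < d)%N ->
  weighted_row h X d =
  \sum_(1 <= n < X.+1 | (d %| n)%N) h (n %/ d)%N * (X - n)%N%:Z.
Proof.
move=> h0 d0; rewrite /weighted_row big_ord_recl /= h0 mul0r add0r.
rewrite -[LHS](big_mkord xpredT (fun i => h i.+1 * (X - d * i.+1)%N%:Z)).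
rewrite -(big_add1 _ _ 0%N X.+1 xpredT (fun e => h e * (X - d * e)%N%:Z)).
rewrite (bigID (fun e => d * e < X.+1)%N) /= [X in _ + X]big1 ?addr0; last first.
  by move=> e; rewrite -leqNgt => le; rewrite (_ : X - _ = 0)%N ?mulr0 //; lia.
rewrite -[RHS]big_filter.
rewrite [RHS](perm_big [seq (d * e)%N | e <- index_iota 1 X.+1 & (d * e < X.+1)%N]) /=.
  rewrite [RHS]big_map [RHS]big_filter; apply: eq_bigr => e _.
  by rewrite mulKn.
apply: uniq_perm; first by rewrite filter_uniq ?iota_uniq.
  rewrite map_inj_in_uniq ?filter_uniq ?iota_uniq // => i j _ _ /eqP.
  by rewrite eqn_pmul2l // => /eqP.
move=> n; rewrite mem_filter mem_index_iota; apply/idP/mapP.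
  case/and3P=> /dvdnP [e ->] n1 n2; exists e; last by rewrite mulnC.
  by rewrite mem_filter mem_index_iota; nia.
case=> e; rewrite mem_filter mem_index_iota => /and3P [h1 h2 h3] ->.
by rewrite dvdn_mulr //; nia.
Qed.

(** Collect the terms of the double sum with the same product n = de. *)
Lemma weighted_sumE (g h : nat -> int) X : g 0%N = 0 -> h 0%N = 0 ->
  weighted_sum g h X = \sum_(1 <= n < X.+1) convolution g h n * (X - n)%N%:Z.
Proof.
move=> g0 h0.
transitivity (\sum_(1 <= n < X.+1) \sum_(0 <= d < X.+1)
   if (d %| n)%N then g d * h (n %/ d)%N * (X - n)%N%:Z else 0).
  rewrite exchange_big /= /weighted_sum big_mkord; apply: eq_bigr => -[d /= _] _.
  case: (posnP d) => [->|d0].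
    by rewrite g0 mul0r big1 // => n _; case: ifP => // _; rewrite !mul0r.
  rewrite weighted_rowE // mulr_sumr -big_mkcond /=; apply: eq_bigr => n _.
  by rewrite mulrA.
rewrite big_nat [RHS]big_nat; apply: eq_bigr => n /andP [n0 nX].
rewrite /convolution -(perm_big _ (@perm_divisors n X.+1 _)); last by rewrite n0.
by rewrite big_filter mulr_suml -big_mkcond.
Qed.

(** A divisor of p^(v+1) m is either p times a divisor of p^v m, or prime to p. *)
Lemma perm_divisors_prime_mul p v m : prime p -> ~~ (p %| m)%N ->
  perm_eq (divisors (p ^ v.+1 * m))
    ([seq (p * d)%N | d <- divisors (p ^ v * m)] ++ divisors m).
Proof.
move=> pp pm; have m0 : (0 < m)%N by case: m pm => //; rewrite dvdn0.
have p0 := prime_gt0 pp.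
have pv k : (0 < p ^ k * m)%N by rewrite muln_gt0 expn_gt0 p0.
apply: uniq_perm; first exact: divisors_uniq.
  rewrite cat_uniq divisors_uniq map_inj_uniq ?divisors_uniq; last first.
    by move=> i j /eqP; rewrite eqn_pmul2l // => /eqP.
  rewrite andbT /=; apply/hasPn => d; rewrite -dvdn_divisors // => dm.
  apply/negP => /mapP [e _ de]; case/negP: pm; apply: dvdn_trans dm.
  by rewrite de dvdn_mulr.
move=> d; rewrite mem_cat -!dvdn_divisors //.
apply/idP/orP; last first.
  case=> [/mapP [e] |dm]; last exact: dvdn_mull.
  by rewrite -dvdn_divisors // => de ->; rewrite expnS -mulnA dvdn_mul.
case: (boolP (p %| d)%N) => [/dvdnP [e ->]|pd] dn.
  left; apply/mapP; exists e; last by rewrite mulnC.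
  by rewrite -dvdn_divisors //; move: dn; rewrite mulnC expnS -mulnA dvdn_pmul2l.
right; move: dn; rewrite Gauss_dvdr //.
by rewrite coprime_sym coprimeXl // prime_coprime.
Qed.

Lemma convolution_prime_pow Q g h p v m :
  real_character Q g -> real_character Q h -> prime p -> ~~ (p %| m)%N ->
  convolution g h (p ^ v * m) =
  (\sum_(i < v.+1) g p ^+ (v - i) * h p ^+ i) * convolution g h m.
Proof.
move=> rg rh pp pm; have m0 : (0 < m)%N by case: m pm => //; rewrite dvdn0.
have p0 := prime_gt0 pp.
elim: v => [|v IHv].
  by rewrite expn0 mul1n big_ord1 !expr0 mulr1 mul1r.
rewrite {1}/convolution (perm_big _ (perm_divisors_prime_mul v pp pm)) big_cat /=.
rewrite big_ord_recr /= subnn expr0 mul1r mulrDl; congr (_ + _).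
  rewrite big_map.
  transitivity (g p * convolution g h (p ^ v * m)).
    rewrite /convolution mulr_sumr; apply: eq_bigr => d _.
    by rewrite (rcM rg) expnS -mulnA divnMl // mulrA.
  rewrite IHv mulrA; congr (_ * _); rewrite mulr_sumr; apply: eq_bigr => -[i /= iv] _.
  by rewrite mulrA -exprS subSn.
rewrite /convolution mulr_sumr !big_seq; apply: eq_bigr => d.
rewrite -dvdn_divisors // => dm.
by rewrite -muln_divA // (rcM rh) (rcX rh); ring.
Qed.

(** The hypothesis on g and h concerns the primes up to B only, so that a finite search
    turns its failure into an actual prime. *)
Section Positivity.
Variables (Q B : nat) (g h : nat -> int).
Hypotheses (rg : real_character Q g) (rh : real_character Q h).
Hypothesis not_both : forall p, prime p -> (p <= B)%N -> ~ (g p = -1 /\ h p = -1).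

(** For p prime to Q, the local sum is v+1 if both values are 1, and 1 or 0 according to
    the parity of v if they have opposite signs; only g p = h p = -1 could give a negative value. *)
Lemma local_factor p v : prime p -> (p <= B)%N ->
  let s := \sum_(i < v.+1) g p ^+ (v - i) * h p ^+ i in
  0 <= s /\ (coprime p Q -> ~~ odd v -> 1 <= s).
Proof.
move=> pp pB s; rewrite {}/s.
have S (x y : int) : x = 1 \/ x = -1 -> y = 1 \/ y = -1 -> ~ (x = -1 /\ y = -1) ->
  let s := \sum_(i < v.+1) x ^+ (v - i) * y ^+ i in 0 <= s /\ (~~ odd v -> 1 <= s).
  move=> hx hy hxy s.
  have sE : s = if (x == 1) && (y == 1) then v.+1%:Z else (~~ odd v)%:R.
    rewrite /s {s}; elim: v => [|n IHn].
      by rewrite big_ord1 !expr0 mulr1; case: ifP.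
    rewrite big_ord_recr /= subnn expr0 mul1r.
    have -> : \sum_(i < n.+1) x ^+ (n.+1 - i) * y ^+ i =
              x * \sum_(i < n.+1) x ^+ (n - i) * y ^+ i.
      rewrite mulr_sumr; apply: eq_bigr => -[i /= ni] _.
      by rewrite mulrA -exprS subSn.
    rewrite IHn {IHn} exprS.
    case: hx hy hxy => -> [] -> hxy; rewrite ?eqxx /=.
    - by rewrite expr1n; lia.
    - by rewrite -signr_odd; case: (odd n).
    - by rewrite expr1n; case: (odd n).
    - by case: hxy.
  by rewrite sE; case: ifP => _; case: odd.
case: (boolP (coprime p Q)) => [cp|ncp].
  by have [? ?] := S _ _ (rc_unit rg cp) (rc_unit rh cp) (not_both pp pB); split.
rewrite (rc_zero rg ncp) (rc_zero rh ncp); split => //.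
by rewrite sumr_ge0 // => i _; rewrite mulr_ge0 ?exprn_ge0.
Qed.

Lemma prime_pow_ind (P : nat -> Prop) : P 1%N ->
  (forall p v m, prime p -> (0 < v)%N -> (0 < m)%N -> ~~ (p %| m)%N -> P m ->
     P (p ^ v * m)%N) ->
  forall n, (0 < n)%N -> P n.
Proof.
move=> P1 Pstep; elim/ltn_ind => n IHn n0.
case: (leqP n 1) => [n1|n1]; first by have -> : n = 1%N by lia.
have pp := pdiv_prime n1; set p := pdiv n in pp.
have [m pm nE] := pfactor_coprime pp n0.
have m0 : (0 < m)%N by move: n0; rewrite nE muln_gt0 => /andP [].
have v0 : (0 < logn p n)%N by rewrite logn_gt0 mem_primes pp n0 pdiv_dvd.
rewrite nE mulnC; apply: Pstep => //; first by rewrite -prime_coprime.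
apply: IHn => //; rewrite [X in (_ < X)%N]nE.
by rewrite ltn_Pmulr // -(exp1n (logn p n)) ltn_exp2r // prime_gt1.
Qed.

Lemma prime_pow_le p v m : (0 < v)%N -> (0 < m)%N -> (0 < p)%N -> (p ^ v * m <= B)%N ->
  (p <= B)%N /\ (m <= B)%N.
Proof.
case: v => // v _ m0 p0; rewrite expnS => le.
have : (0 < p ^ v)%N by rewrite expn_gt0 p0.
move: (p ^ v)%N le => w le w0; split; apply: leq_trans le; last by rewrite leq_pmull // muln_gt0 p0.
by rewrite -mulnA leq_pmulr // muln_gt0 w0.
Qed.

Lemma convolution1 : convolution g h 1 = 1.
Proof. by rewrite /convolution (_ : divisors 1 = [:: 1%N]) // big_seq1 divn1 (rc1 rg) (rc1 rh). Qed.

Lemma convolution_ge0 n : (0 < n)%N -> (n <= B)%N -> 0 <= convolution g h n.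
Proof.
move: n; apply: (@prime_pow_ind (fun n => (n <= B)%N -> 0 <= convolution g h n)).
  by rewrite convolution1.
move=> p v m pp v0 m0 pm IHm nB.
have [pB mB] := prime_pow_le v0 m0 (prime_gt0 pp) nB.
by rewrite (convolution_prime_pow v rg rh pp pm) mulr_ge0 ?IHm // (local_factor v pp pB).1.
Qed.

Lemma convolution_sqr_ge1 n : (0 < n)%N -> (n <= B)%N -> coprime n Q ->
  1 <= convolution g h (n ^ 2).
Proof.
move: n; apply: (@prime_pow_ind (fun n => (n <= B)%N -> coprime n Q ->
    1 <= convolution g h (n ^ 2)%N)) => [_ _|p v m pp v0 m0 pm IHm nB].
  by rewrite exp1n convolution1.
have [pB mB] := prime_pow_le v0 m0 (prime_gt0 pp) nB.
rewrite coprimeMl coprime_pexpl // => /andP [cp cm].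
rewrite expnMn -expnM (convolution_prime_pow (v * 2) rg rh pp); last first.
  by rewrite Euclid_dvdX // andbT.
apply: mulr_ege1; last exact: IHm.
by apply: (local_factor (v * 2) pp pB).2 => //; rewrite oddM andbF.
Qed.
End Positivity.

(** Each dyadic block of the harmonic sum contributes at most X, up to rounding. *)
Lemma harmonic_bound X K :
  (\sum_(1 <= d < 2 ^ K) (X + d) %/ d.+1 <= K * X + 2 ^ K)%N.
Proof.
elim: K => [|K IHK]; first by rewrite big_geq.
rewrite (big_cat_nat (n := 2 ^ K)) /= ?expn_gt0 ?leq_exp2l //.
have le : (\sum_(2 ^ K <= d < 2 ^ K.+1) (X + d) %/ d.+1 <= X + 2 ^ K)%N.
  rewrite big_nat; apply: (@leq_trans (\sum_(2 ^ K <= d < 2 ^ K.+1) (X %/ 2 ^ K + 1))).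
    rewrite [X in (_ <= X)%N]big_nat; apply: leq_sum => d /andP [d1 d2].
    have le1 : (X %/ d.+1 <= X %/ 2 ^ K)%N by apply: leq_div2l; rewrite ?expn_gt0 //; lia.
    apply: leq_trans (_ : X %/ d.+1 + 1 <= _)%N; last by rewrite leq_add2r.
    have <- : (d.+1 %/ d.+1 = 1)%N by rewrite divnn.
    by rewrite -divnDr // leq_div2r // leq_add2l.
  rewrite sum_nat_const_nat (_ : 2 ^ K.+1 - 2 ^ K = 2 ^ K)%N; last by rewrite expnS; lia.
  by rewrite mulnDr muln1 leq_add2r mulnC leq_trunc_div.
by apply: leq_trans (leq_add IHK le) _; rewrite mulSn expnS; lia.
Qed.

Lemma linear_le_exp A B : exists k, (A * k + B <= 2 ^ k)%N.
Proof.
exists (2 * (2 * A + B))%N; set i := (2 * A + B)%N.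
have lti : (i < 2 ^ i)%N by apply: ltn_expl.
rewrite [X in (_ <= X)%N](_ : _ = 2 ^ i * 2 ^ i)%N; last by rewrite -expnD addnn mul2n.
by apply: leq_trans (_ : i.+1 * i.+1 <= _)%N; [rewrite /i; nia | rewrite leq_mul].
Qed.

(** If no prime up to X qualified, the weighted sum of the convolution would be too small:
    the squares (1 + jQ)^2 alone contribute about X^(3/2) / Q, while the sum is at most
    2 Q^2 times X times a harmonic sum. *)
Theorem two_characters_common_N1 Q g h u v :
  (0 < Q)%N -> real_character Q g -> real_character Q h ->
  g u = -1 -> h v = -1 ->
  exists p, [/\ prime p, g p = -1 & h p = -1].
Proof.
move=> Q0 rg rh gu hv.
(* J exceeds 4 Q^2 (2k + 3), and k is so large that 2 (1 + JQ)^2 <= X = 4^k. *)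
have [k kP] := linear_le_exp (16 * Q ^ 3) (64 * Q ^ 3 + 2 * Q + 4).
pose J := (4 * Q ^ 2 * (2 * k + 4) + 1)%N.
set X := (4 ^ k)%N.
case: (boolP [exists p : 'I_X.+1, [&& prime p, g p == -1 & h p == -1]]).
  by case/existsP => p /and3P [pp /eqP gp /eqP hp]; exists p.
rewrite negb_exists => /forallP none.
have not_both p : prime p -> (p <= X)%N -> ~ (g p = -1 /\ h p = -1).
  move=> pp pX [gp hp]; have := none (Ordinal (pX : p < X.+1)%N).
  by rewrite /= pp gp hp.
exfalso.
have X0 : (0 < X)%N by rewrite expn_gt0.
have XE : X = (2 ^ k * 2 ^ k)%N by rewrite -expnD addnn -mul2n expnM.
have g0 : g 0%N = 0.
  apply: (rc_zero rg); rewrite /coprime gcd0n; apply/eqP => Q1; subst Q.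
  have := rc_eqmod rg (_ : u = 1 %[mod 1]); rewrite !modn1 => /(_ erefl).
  by rewrite gu (rc1 rg).
have h0 : h 0%N = 0.
  apply: (rc_zero rh); rewrite /coprime gcd0n; apply/eqP => Q1; subst Q.
  have := rc_eqmod rg (_ : u = 1 %[mod 1]); rewrite !modn1 => /(_ erefl).
  by rewrite gu (rc1 rg).
have kX : (2 ^ k <= X)%N by rewrite XE leq_pmulr // expn_gt0.
have JQ : (2 * (1 + J * Q) <= 2 ^ k)%N.
  by apply: leq_trans kP; rewrite /J !expnS expn0; nia.
have upper : `|weighted_sum g h X| <= (2 * Q ^ 2 * ((2 * k + 3) * X))%N%:Z.
  apply: le_trans (weighted_sum_bound X Q0 rg rh gu hv) _.
  have -> : 2 * Q%:Z ^+ 2 = (2 * Q ^ 2)%N%:Z by rewrite -mulnn expr2; lia.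
  rewrite -PoszM lez_nat leq_mul2l; apply/orP; right.
  apply: leq_trans (_ : \sum_(1 <= d < 2 ^ (2 * k).+1) (X + d) %/ d.+1 <= _)%N.
    have XE2 : (2 ^ (2 * k).+1 = X + X)%N by rewrite expnS expnM mul2n addnn.
    by rewrite [X in (_ <= X)%N](big_cat_nat (n := X.+1)) ?leq_addr //; lia.
  apply: leq_trans (harmonic_bound _ _) _.
  by rewrite expnS expnM -/X; lia.
have lower : (J * X)%N%:Z <= 2 * weighted_sum g h X.
  pose s := [seq ((1 + j * Q) ^ 2)%N | j <- iota 0 J].
  have sX n : n \in s -> (0 < n)%N /\ (2 * n <= X)%N /\ 1 <= convolution g h n.
    case/mapP=> j; rewrite mem_iota /= add0n => jJ ->; split; first by rewrite expn_gt0.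
    have jQ : (1 + j * Q <= 1 + J * Q)%N by rewrite leq_add2l leq_mul2r ltnW ?orbT.
    move: (J * Q)%N jQ JQ => JQ' jQ JQ.
    split; last first.
      apply: (convolution_sqr_ge1 rg rh not_both) => //; first by apply: leq_trans kX; lia.
      by rewrite /coprime gcdnC addnC gcdnMDl gcdn1.
    rewrite XE -mulnn; nia.
  have us : uniq s.
    rewrite map_inj_uniq ?iota_uniq // => i j /eqP; rewrite eqn_sqr => /eqP; nia.
  rewrite weighted_sumE // (bigID (mem s)) /= mulrDr.
  apply: ler_wpDr.
    apply: mulr_ge0 => //; rewrite big_nat_cond; apply: sumr_ge0 => n /andP [/andP [n1 nX] _].
    by rewrite mulr_ge0 // (convolution_ge0 rg rh not_both) //; lia.
  rewrite -big_filter (perm_big s) /=; last first.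
    apply: uniq_perm => //; first by rewrite filter_uniq ?iota_uniq.
    move=> n; rewrite mem_filter mem_index_iota; apply/andP/idP => [[]//|ns].
    by have [? [? _]] := sX n ns; split=> //; lia.
  have -> : (J * X)%N%:Z = \sum_(n <- s) X%:Z.
    by rewrite big_map big_const_seq count_predT size_iota iter_addr_0 -mulr_natl natz PoszM.
  rewrite mulr_sumr !big_seq; apply: ler_sum => n ns.
  by have [n0 [nX F1]] := sX n ns; nia.
have : (J * X <= 2 * (2 * Q ^ 2 * ((2 * k + 3) * X)))%N by lia.
by rewrite !mulnA leq_pmul2r // /J; nia.
Qed.

(** * Quadratic reciprocity *)

Definition legendre (a : int) (p : nat) : int :=
  let x : 'F_p := a%:~R in
  if x == 0 then 0 else if x ^+ p./2 == 1 then 1 else -1.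

Section Legendre.
Variable p : nat.
Hypotheses (pp : prime p) (oddp : odd p).

Let h := p./2.
Let pE : p = h.*2.+1.
Proof. by rewrite /h -[LHS]odd_double_half oddp. Qed.

Lemma Fp_nat_eq0 n : (n%:R == 0 :> 'F_p) = (p %| n)%N.
Proof. by rewrite -(dvdn_pcharf (pchar_Fp pp)). Qed.

Lemma Fp_two_neq0 : 2%:R != 0 :> 'F_p.
Proof.
rewrite Fp_nat_eq0; apply/negP => /(dvdn_leq (ltn0Sn _)).
by have := prime_gt1 pp; move: oddp pE; lia.
Qed.

Lemma Fp_fermat (x : 'F_p) : x != 0 -> x ^+ h.*2 = 1.
Proof.
move=> x0; apply: (mulfI x0); rewrite -exprS -pE mulr1.
by rewrite -[X in x ^+ X](card_Fp pp) expf_card.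
Qed.

Lemma Fp_expr_half (x : 'F_p) : x != 0 -> x ^+ h = 1 \/ x ^+ h = -1.
Proof.
move=> x0; have /eqP := Fp_fermat x0.
by rewrite -muln2 exprM sqrf_eq1 => /orP [] /eqP; [left | right].
Qed.

Lemma legendre_euler a : (legendre a p)%:~R = a%:~R ^+ h :> 'F_p.
Proof.
rewrite /legendre; case: eqP => [->|/eqP x0].
  by rewrite expr0n (_ : h == 0%N = false) //; have := prime_gt1 pp; move: pE; lia.
case: eqP => [->//|nx]; case: (Fp_expr_half x0) => // ->.
Qed.

(** For odd p the integers 0, 1, -1 are distinct modulo p, so identities between Legendre
    symbols can be checked in 'F_p. *)
Lemma Fp_sign_inj (e f : int) : e \in [:: 0; 1; -1] -> f \in [:: 0; 1; -1] ->
  e%:~R = f%:~R :> 'F_p -> e = f.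
Proof.
have N := Fp_two_neq0; have Z : (1 != 0 :> 'F_p) by apply: oner_neq0.
have D : (1 == -1 :> 'F_p) = false.
  by apply/negbTE; rewrite -addr_eq0 -natr1 mulr1n in N *.
rewrite !inE => /or3P [] /eqP -> /or3P [] /eqP -> //= /eqP;
  rewrite ?mulrNz ?mulr0z ?mulr1z ?oppr_eq0 ?(negbTE Z) // 1?eq_sym ?oppr_eq0 ?(negbTE Z) ?D //.
by rewrite eq_sym D.
Qed.

Lemma legendre_vals a : legendre a p \in [:: 0; 1; -1].
Proof. by rewrite /legendre; case: ifP => // _; case: ifP. Qed.

Lemma legendreM a b : legendre (a * b) p = legendre a p * legendre b p.
Proof.
apply: Fp_sign_inj; first exact: legendre_vals.
  have := legendre_vals a; have := legendre_vals b.
  by rewrite !inE => /or3P [] /eqP -> /or3P [] /eqP ->.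
by rewrite intrM !legendre_euler intrM exprMn.
Qed.

Lemma legendre_character : real_character p (fun a => legendre a p).
Proof.
split.
- by move=> a b; rewrite PoszM legendreM.
- move=> a; rewrite /legendre PoszD rmorphD /=.
  by rewrite -[X in _ + X]/(p%:R : 'F_p) pchar_Fp_0 // addr0.
- move=> a; rewrite coprime_sym prime_coprime // => pa.
  rewrite /legendre; case: eqP => [/eqP|_]; last by case: ifP; [left|right].
  by rewrite -[_%:~R]/(a%:R) Fp_nat_eq0 (negbTE pa).
- move=> a; rewrite coprime_sym prime_coprime // negbK => pa.
  by rewrite /legendre -[_%:~R]/(a%:R) Fp_nat_eq0 pa.
Qed.

Lemma legendreN1 : legendre (-1) p = (-1) ^+ h.
Proof.
apply: Fp_sign_inj; first exact: legendre_vals.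
  by rewrite -signr_odd; case: odd.
by rewrite legendre_euler rmorphXn.
Qed.

(** If x = z^i with z a generator of the multiplicative group, then x^h = 1 forces i to be
    even. *)
Lemma legendre_square (M : int) : legendre M p = 1 ->
  exists k : nat, (p %| k%:Z ^+ 2 - M)%Z.
Proof.
move=> LM; set x : 'F_p := M%:~R.
have xh : x ^+ h = 1 by rewrite -legendre_euler LM.
have h0 : (0 < h)%N by have := prime_gt1 pp; move: pE; lia.
have [z zP] : exists z : 'F_p, h.*2.-primitive_root z.
  have /hasP [z _ ?] : has (h.*2).-primitive_root (enum (predC1 (0 : 'F_p))); last by exists z.
  apply: has_prim_root; rewrite ?enum_uniq ?double_gt0 //.
  - apply/allP => y; rewrite mem_enum => y0.
    by apply/unity_rootP; rewrite Fp_fermat.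
  - by rewrite -cardE cardC1 card_Fp // pE.
have x2 : x ^+ h.*2 = 1 by rewrite -muln2 exprM xh expr1n.
have [[i /= _] xi] := prim_rootP zP x2.
move/eqP: xh; rewrite xi -exprM -(prim_order_dvd zP) -muln2 mulnC dvdn_pmul2r // => /dvdnP [j ij].
exists (val (z ^+ j)).
rewrite (dvdz_pcharf (pchar_Fp pp)) rmorphB rmorphXn /= -/x xi ij.
by rewrite -[(_ %:Z)%:~R]/(_%:R) natr_Zp exprM subrr.
Qed.

(** For k < h, t k is the absolute value of the residue of a (k+1) that is least in absolute
    value; t permutes 1, ..., h, and mu counts the negative residues. *)
Section GaussLemma.
Variable a : nat.
Hypothesis pa : ~~ (p %| a)%N.

Let r (k : nat) := ((a * k.+1) %% p)%N.
Let t (k : nat) := if (r k <= h)%N then r k else (p - r k)%N.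

Let p0 : (0 < p)%N. Proof. exact: prime_gt0. Qed.

Let t_range k : (k < h)%N -> (0 < t k <= h)%N.
Proof.
move=> kh; have r0 : (0 < r k)%N.
  rewrite lt0n; apply/negP => /eqP /eqP; rewrite -/(dvdn p _) Euclid_dvdM // (negbTE pa) /=.
  by move/(dvdn_leq (ltn0Sn _)); move: pE; lia.
have : (r k < p)%N by rewrite ltn_mod.
by rewrite /t; case: ifP; move: pE; lia.
Qed.

Let tp_lt (k : 'I_h) : ((t k).-1 < h)%N.
Proof. by have := t_range (ltn_ord k); lia. Qed.

Let s (k : 'I_h) : 'I_h := Ordinal (tp_lt k).

Let s_inj : injective s.
Proof.
move=> i j /(congr1 val) /= eij; have ti := t_range (ltn_ord i); have tj := t_range (ltn_ord j).
have {}eij : t i = t j by lia.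
have ih := ltn_ord i; have jh := ltn_ord j.
have rp k : (r k < p)%N by rewrite ltn_mod.
have R k : (a * k.+1 = (a * k.+1) %/ p * p + r k)%N by rewrite /r -divn_eq.
have Sum : (p %| a * (i + j).+2)%N -> False.
  rewrite Euclid_dvdM // (negbTE pa) /= => /(dvdn_leq (ltn0Sn _)); move: pE; lia.
have Dif (u v : 'I_h) : (u <= v)%N -> r u = r v -> u = v.
  move=> uv ruv; apply/val_inj => /=.
  have : (p %| a * (v - u))%N.
    have := R u; have := R v; rewrite ruv => e1 e2.
    have -> : (a * (v - u) = a * v.+1 - a * u.+1)%N by rewrite -mulnBr subSS.
    by rewrite e1 e2 subnDr -mulnBl dvdn_mull.
  rewrite Euclid_dvdM // (negbTE pa) /= => /dvdnP [[|c] E]; first by lia.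
  by have := ltn_ord v; move: pE; nia.
have Same : r i = r j -> i = j.
  by move=> e; case: (leqP i j) => [/Dif|/ltnW /Dif W]; [apply | rewrite W].
have Opp : (r i + r j)%N = p -> False.
  move=> e; apply: Sum.
  have -> : (a * (i + j).+2 = a * i.+1 + a * j.+1)%N by ring.
  by rewrite (R i) (R j) addnACA e -mulnDl dvdn_add ?dvdn_mull.
move: eij; rewrite /t; case: ifP => _; case: ifP => _ e.
- exact: Same.
- by case: Opp; have := rp j; lia.
- by case: Opp; have := rp i; lia.
- by apply: Same; have := rp i; have := rp j; lia.
Qed.

Let mu := (\sum_(k < h) (h < r k))%N.

(** Compare the product of the a (k+1) with h! in 'F_p. *)
Lemma gauss_lemma : legendre a p = (-1) ^+ mu.
Proof.
apply: Fp_sign_inj; first exact: legendre_vals.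
  by rewrite -signr_odd; case: odd.
rewrite legendre_euler rmorphXn /=.
have fact_neq0 : \prod_(k < h) (k.+1)%:R != 0 :> 'F_p.
  apply/prodf_neq0 => k _; rewrite Fp_nat_eq0.
  by apply/negP => /(dvdn_leq (ltn0Sn _)); have := ltn_ord k; move: pE; lia.
apply: (mulIf fact_neq0).
transitivity (\prod_(k < h) (r k)%:R : 'F_p).
  rewrite -[X in _ ^+ X](card_ord h) -prodr_const -big_split /=.
  by apply: eq_bigr => k _; rewrite /r Fp_nat_mod // natrM.
transitivity (\prod_(k < h) ((-1) ^+ (h < r k)%N * (t k)%:R : 'F_p)).
  apply: eq_bigr => k _; rewrite /t; case: (leqP (r k) h) => _ /=; first by rewrite mul1r.
    by rewrite mulN1r natrB ?(ltnW (ltn_pmod _ _)) // pchar_Fp_0 // sub0r opprK.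
rewrite big_split /= -expr_sum; congr (_ * _).
rewrite [RHS](reindex_inj s_inj) /=; apply: eq_bigr => k _.
by rewrite prednK //; case/andP: (t_range (ltn_ord k)).
Qed.

(** Sum a (k+1) = p q + r over k and reduce modulo 2: since p is odd, t k and r k differ in
    parity exactly when the residue is negative. *)
Lemma gauss_lemma_parity :
  odd mu = odd (a.+1 * 'C(h.+1, 2) + \sum_(k < h) (a * k.+1) %/ p).
Proof.
have sumk : (\sum_(k < h) k.+1 = 'C(h.+1, 2))%N.
  by rewrite -bin2_sum big_mkord big_ord_recl /= add0n.
have sumt : (\sum_(k < h) t k = 'C(h.+1, 2))%N.
  rewrite -sumk [RHS](reindex_inj s_inj) /=; apply: eq_bigr => k _.
  by rewrite prednK //; case/andP: (t_range (ltn_ord k)).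
have E : odd (\sum_(k < h) (t k + (h < r k) + (a * k.+1) %/ p + a * k.+1)) = false.
  rewrite (big_morph odd oddD erefl) big1 // => k _.
  have R : (a * k.+1 = (a * k.+1) %/ p * p + r k)%N by rewrite /r -divn_eq.
  have rp : (r k < p)%N by rewrite ltn_mod.
  rewrite !oddD {2}R oddD oddM oddp andbT /t.
  case: (leqP (r k) h) => _; rewrite ?oddB ?(ltnW rp) // ?oddp;
    by case: (odd (r k)); case: (odd (_ %/ _)).
move: E; rewrite !big_split -big_distrr /= sumk sumt -/mu.
move: 'C(_, _) => C; rewrite mulSn !oddD !oddM.
by case: (odd mu); case: (odd C); case: (odd (\sum_(_ < _) _)); case: (odd a).
Qed.
End GaussLemma.

Lemma legendre_odd (a : nat) : odd a -> ~~ (p %| a)%N ->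
  legendre a p = (-1) ^+ (\sum_(k < h) (a * k.+1) %/ p)%N.
Proof.
move=> oa pa; rewrite gauss_lemma // -signr_odd gauss_lemma_parity //.
by rewrite oddD oddM /= oa signr_odd.
Qed.

Lemma legendre2 : legendre 2 p = (-1) ^+ 'C(h.+1, 2).
Proof.
have p2 : ~~ (p %| 2)%N by rewrite -Fp_nat_eq0 Fp_two_neq0.
rewrite (gauss_lemma p2) -signr_odd gauss_lemma_parity // oddD oddM /=.
rewrite (_ : \sum_(k < h) _ = 0)%N ?addbF ?signr_odd // big1 // => k _.
by rewrite divn_small //; have := ltn_ord k; move: pE; lia.
Qed.
End Legendre.

Lemma divn_count n v H : (0 < v)%N -> (n %/ v <= H)%N ->
  (n %/ v = \sum_(l < H) (v * l.+1 <= n))%N.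
Proof.
move=> v0 nH.
have -> : (\sum_(l < H) (v * l.+1 <= n) = \sum_(l < H) (l < n %/ v))%N.
  by apply: eq_bigr => l _; rewrite mulnC leq_divRL.
move: (n %/ v)%N nH => m mH; rewrite -(subnKC mH) big_split_ord /=.
rewrite [X in (X + _)%N](eq_bigr (fun=> 1%N)) => [|i _]; last by rewrite ltn_ord.
rewrite sum1_card card_ord big1 ?addn0 // => i _.
by rewrite ltnNge leq_addr.
Qed.

(** The two sums of quotients count the points of the p./2 by q./2 rectangle on either side
    of its diagonal, which contains no lattice point. *)
Theorem quadratic_reciprocity p q : prime p -> prime q -> odd p -> odd q -> p != q ->
  legendre p q * legendre q p = (-1) ^+ (p./2 * q./2).
Proof.
move=> pp pq op oq neq.
have pNq : ~~ (p %| q)%N by rewrite dvdn_prime2.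
have qNp : ~~ (q %| p)%N by rewrite dvdn_prime2 // eq_sym.
rewrite legendre_odd // (legendre_odd pp) // -exprD; congr (_ ^+ _).
have count u v (k : 'I_(v./2)) : odd u -> odd v ->
  ((u * k.+1) %/ v = \sum_(l < u./2) (v * l.+1 <= u * k.+1))%N.
  move=> ou ov; have kv := ltn_ord k; have uE := odd_double_half u.
  have vE := odd_double_half v; rewrite ou in uE; rewrite ov in vE.
  apply: divn_count; first by lia.
  by rewrite -ltnS ltn_divLR; [nia | lia].
rewrite (eq_bigr _ (fun k _ => count p q k op oq)).
rewrite (eq_bigr _ (fun k _ => count q p k oq op)) [X in (_ + X)%N]exchange_big -big_split /=.
rewrite mulnC -[X in _ = (X * _)%N]card_ord -sum_nat_const; apply: eq_bigr => k _.
rewrite -big_split /= -[RHS]card_ord -sum1_card; apply: eq_bigr => l _.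
have : (q * l.+1 != p * k.+1)%N.
  apply/eqP => E; have : (q %| p * k.+1)%N by rewrite -E dvdn_mulr.
  rewrite Euclid_dvdM // (negbTE qNp) /= => /(dvdn_leq (ltn0Sn _)).
  by have := ltn_ord k; have := odd_double_half q; have := prime_gt0 pq; lia.
by case: ltngtP.
Qed.

(** * The Kronecker character of -M *)

Lemma rc_mul_exp Q f g k : real_character Q f -> real_character Q g ->
  real_character Q (fun a => f a * g a ^+ k).
Proof.
move=> rf rg; split=> a.
- by move=> b; rewrite (rcM rf) (rcM rg) exprMn mulrACA.
- by rewrite (rcD rf) (rcD rg).
- move=> ca; have gk : g a ^+ k = 1 \/ g a ^+ k = -1.
    case: (rc_unit rg ca) => ->; first by left; rewrite expr1n.
    by rewrite -signr_odd; case: odd; [right | left].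
  by case: (rc_unit rf ca) => ->; case: gk => ->;
    rewrite ?mulN1r ?mul1r ?opprK; [left|right|right|left].
- by move=> ca; rewrite (rc_zero rf ca) mul0r.
Qed.

Lemma rc_mul_modulus Q R f g : real_character Q f -> real_character R g ->
  real_character (Q * R) (fun a => f a * g a).
Proof.
move=> rf rg; split=> a.
- by move=> b; rewrite (rcM rf) (rcM rg) mulrACA.
- by rewrite (rcDM rg) mulnC (rcDM rf).
- by rewrite coprimeMr => /andP [cf cg]; case: (rc_unit rf cf) => ->; case: (rc_unit rg cg) => ->;
    rewrite ?mulN1r ?mul1r ?opprK; [left|right|right|left].
- by rewrite coprimeMr negb_and => /orP [] c; rewrite ?(rc_zero rf c) ?(rc_zero rg c) ?mul0r ?mulr0.
Qed.

(** The values of the Jacobi symbols (-1/a) and, for [chi8], (2/a). *)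
Definition chi4 (a : nat) : int := if odd a then if (a %% 4 == 1)%N then 1 else -1 else 0.

Definition chi8 (a : nat) : int :=
  if odd a then if (a %% 8 == 1)%N || (a %% 8 == 7)%N then 1 else -1 else 0.

Lemma odd_mod8 a : odd (a %% 8) = odd a.
Proof. by rewrite {2}(divn_eq a 8) oddD oddM andbF. Qed.

Lemma mod8_mod4 a : ((a %% 8) %% 4 = a %% 4)%N.
Proof. by rewrite modn_dvdm. Qed.

Lemma chi4_mod8 a : chi4 a = chi4 (a %% 8).
Proof. by rewrite /chi4 odd_mod8 mod8_mod4. Qed.

Lemma chi8_mod8 a : chi8 a = chi8 (a %% 8).
Proof. by rewrite /chi8 odd_mod8 modn_mod. Qed.

Lemma real_character8 f : (forall a, f a = f (a %% 8)%N) ->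
  all (fun i => all (fun j => f (i * j)%N == f i * f j) (iota 0 8)) (iota 0 8) ->
  all (fun i => if odd i then (f i == 1) || (f i == -1) else f i == 0) (iota 0 8) ->
  real_character 8 f.
Proof.
move=> fmod /allP fM /allP fv.
have cop a : coprime a 8 = odd a by rewrite (_ : 8 = 2 ^ 3)%N // coprime_pexpr // coprimen2.
have mod8 a : (a %% 8)%N \in iota 0 8 by rewrite mem_iota ltn_mod.
have val a : if odd a then (f a == 1) || (f a == -1) else f a == 0.
  by have := fv _ (mod8 a); rewrite odd_mod8 -fmod.
split=> a.
- move=> b; rewrite fmod -modnMm -fmod (fmod a) (fmod b).
  by have /allP /(_ _ (mod8 b)) /eqP := fM _ (mod8 a).
- by rewrite fmod modnDr -fmod.
- by rewrite cop => oa; have := val a; rewrite oa => /orP [] /eqP ->; [left|right].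
- by rewrite cop => /negbTE oa; have := val a; rewrite oa => /eqP.
Qed.

Lemma chi4_character : real_character 8 chi4.
Proof. exact: real_character8 chi4_mod8 isT isT. Qed.

Lemma chi8_character : real_character 8 chi8.
Proof. exact: real_character8 chi8_mod8 isT isT. Qed.

Lemma chi4E a : odd a -> chi4 a = (-1) ^+ a./2.
Proof.
move=> oa; rewrite /chi4 oa -signr_odd.
have E := odd_double_half a; rewrite oa in E.
have E2 := odd_double_half a./2; move: E2 E; case: (odd _) => E2 E.
  by rewrite (_ : a %% 4 = 3)%N //; lia.
by rewrite (_ : a %% 4 = 1)%N //; lia.
Qed.

Lemma chi8E a : odd a -> chi8 a = (-1) ^+ 'C(a./2.+1, 2).
Proof.
move=> oa; rewrite /chi8 oa -signr_odd bin2 /=.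
have E := odd_double_half a; rewrite oa in E.
have : (a./2 %% 4 < 4)%N by rewrite ltn_mod.
have := divn_eq a./2 4; move: (a./2 %/ 4)%N (a./2 %% 4)%N => q [|[|[|[|//]]]] Eq _.
- have -> : (a %% 8 = 1)%N by lia.
  rewrite Eq (_ : (_ * _)./2 = (2 * (q * (4 * q).+1))%N); last by lia.
  by rewrite oddM.
- have -> : (a %% 8 = 3)%N by lia.
  rewrite Eq (_ : (_ * _)./2 = (2 * (q * (4 * q + 3))).+1%N); last by lia.
  by rewrite /= oddM.
- have -> : (a %% 8 = 5)%N by lia.
  rewrite Eq (_ : (_ * _)./2 = (2 * (4 * q * q + 5 * q + 1)).+1%N); last by lia.
  by rewrite /= oddM.
- have -> : (a %% 8 = 7)%N by lia.
  rewrite Eq (_ : (_ * _)./2 = (2 * (4 * q * q + 7 * q + 3))%N); last by lia.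
  by rewrite oddM.
Qed.

Lemma legendre_predn p a : prime p -> (p %| a.+1)%N -> legendre a p = legendre (-1) p.
Proof.
move=> pp pa; rewrite /legendre; suff -> : (a%:Z)%:~R = (-1)%:~R :> 'F_p by [].
apply/eqP; rewrite mulrNz mulr1z -subr_eq0 opprK -[_%:~R]/(a%:R) natr1.
by rewrite -(dvdn_pcharf (pchar_Fp pp)).
Qed.

Lemma sign_half_mul p m r : odd p -> odd m ->
  (-1) ^+ (r * (p * m)./2) = (-1) ^+ (r * p./2) * (-1) ^+ (r * m./2) :> int.
Proof.
move=> op om; rewrite -exprD -signr_odd -[RHS]signr_odd; congr ((-1) ^+ nat_of_bool _).
have := odd_double_half p; have := odd_double_half m; rewrite op om => Em Ep.
have -> : ((p * m)./2 = (p./2 * m./2).*2 + p./2 + m./2)%N.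
  by rewrite -{1}Em -{1}Ep; lia.
by rewrite -mulnDr !oddM !oddD odd_double.
Qed.

Lemma prime_mul_ind (P : nat -> Prop) : P 1%N ->
  (forall p m, prime p -> (0 < m)%N -> P m -> P (p * m)%N) ->
  forall n, (0 < n)%N -> P n.
Proof.
move=> P1 Pstep; elim/ltn_ind => n IHn n0.
case: (leqP n 1) => [n1|n1]; first by have -> : n = 1%N by lia.
have pp := pdiv_prime n1; have /dvdnP [m nE] := pdiv_dvd n.
have p1 := prime_gt1 pp.
have m0 : (0 < m)%N by case: m nE => //; lia.
by rewrite nE mulnC; apply: Pstep => //; apply: IHn => //; rewrite [X in (_ < X)%N]nE; nia.
Qed.

(** chi is the Jacobi symbol with denominator n.  Reciprocity relates its value at a prime r
    to the symbol with denominator r; its values at -1 and 2 decide which classes lie in the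
    kernel of the characters built from it. *)
Lemma jacobi_character n : odd n -> exists chi,
  [/\ real_character n chi,
      forall r, prime r -> odd r -> ~~ (r %| n)%N ->
        chi r = legendre n r * (-1) ^+ (r./2 * n./2),
      forall a, (n %| a.+1)%N -> chi a = chi4 n & chi 2%N = chi8 n].
Proof.
move=> on; have n0 : (0 < n)%N by case: n on.
move: n n0 on; apply: (@prime_mul_ind (fun n => odd n -> _)).
  move=> _; exists (fun=> 1); split=> //.
    split=> //; first by left.
    by move=> a; rewrite coprimen1.
  move=> r pr or _; rewrite muln0 expr0 mulr1 /legendre mulr1z.
  by rewrite oner_eq0 expr1n eqxx.
move=> p m pp m0 IHm; rewrite oddM => /andP [op om].
have [chi [rchi chi_r chi_N1 chi_2]] := IHm om.
exists (fun a : nat => legendre a p * chi a); split.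
- exact: rc_mul_modulus (legendre_character pp op) rchi.
- move=> r pr or; rewrite Euclid_dvdM // negb_or => /andP [rp rm].
  rewrite chi_r // PoszM legendreM // sign_half_mul //.
  have neq : r != p by apply: contra rp => /eqP ->.
  have := quadratic_reciprocity pr pp or op neq => QR.
  have L1 : legendre p r ^+ 2 = 1.
    have /rc_unit -/(_ p) := legendre_character pr or.
    rewrite coprime_sym prime_coprime // => /(_ rp) [] ->; exact: sqrrN || by [].
  by rewrite -QR -[LHS]mul1r -L1; ring.
- move=> a pma; have Npa : (p %| a.+1)%N by apply: dvdn_trans pma; rewrite dvdn_mulr.
  have Nma : (m %| a.+1)%N by apply: dvdn_trans pma; rewrite dvdn_mull.
  by rewrite chi_N1 // legendre_predn // legendreN1 // -chi4E // (rcM chi4_character).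
- by rewrite chi_2 legendre2 // -chi8E // (rcM chi8_character).
Qed.

(** chi extends r |-> (-M/r).  If M = 1 modulo 4 or M is even, a class u with u = -1 modulo
    M and a suitable residue modulo 8 has chi u = 1.  If M = 3 modulo 4, then chi u = -1
    whatever the residue modulo 8; but for M = 3 modulo 8 also (2/M) = -1, so that a class u
    with 2u = -1 modulo M has chi u = 1, which is the case s = 2. *)
Lemma kronecker_character M : (0 < M)%N -> ~~ (4 %| M)%N -> (M %% 8 != 7)%N ->
  exists Q chi u s,
    [/\ (1 < Q)%N, real_character Q chi, chi u = 1, (M %| Q)%N & (s = 1 \/ s = 2 /\ odd M)%N] /\
    (M %| (s * u).+1)%N /\
    (forall r, prime r -> chi r = 1 ->
       odd r /\ ~~ (r %| M)%N /\ exists k : nat, (r %| k ^ 2 + M)%N).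
Proof.
move=> M0 M4 M7.
pose n := if odd M then M else M./2.
have on : odd n.
  rewrite /n; case: ifP => // eM; apply: contraR M4 => eM2.
  have := odd_double_half M; have := odd_double_half M./2.
  by rewrite eM (negbTE eM2) => E1 E2; apply/dvdnP; exists (M./2./2); lia.
have [chi [rchi chi_r chi_N1 chi_2]] := jacobi_character on.
pose f := if odd M then chi4 else chi8.
have rf : real_character 8 f.
  by rewrite /f; case: ifP => _; [apply: chi4_character | apply: chi8_character].
pose k := (if odd M then n./2 else n./2.+1).
pose X a := f a * chi4 a ^+ k * chi a.
have rX : real_character (8 * n) X.
  exact: rc_mul_modulus (rc_mul_exp k rf chi4_character) rchi.
have MQ : (M %| 8 * n)%N.
  rewrite /n; case: ifP => eM; first by rewrite dvdn_mull.
  by apply/dvdnP; exists 4%N; have := odd_double_half M; rewrite eM; lia.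
have split_primes r : prime r -> X r = 1 ->
    odd r /\ ~~ (r %| M)%N /\ exists k : nat, (r %| k ^ 2 + M)%N.
  move=> pr Xr.
  have cr : coprime r (8 * n).
    by apply/negPn/negP => /(rc_zero rX); rewrite Xr.
  have or : odd r.
    by move: cr; rewrite coprimeMr (_ : 8 = 2 ^ 3)%N // coprime_pexpr // coprimen2 => /andP [].
  have rM : ~~ (r %| M)%N.
    rewrite -prime_coprime //; apply: coprime_dvdr cr; exact: MQ.
  have rn : ~~ (r %| n)%N.
    by rewrite -prime_coprime //; move: cr; rewrite coprimeMr => /andP [].
  split=> //; split=> //.
  have c4 : chi4 r ^+ 2 = 1.
    by rewrite chi4E // -exprM mulnC exprM sqrrN expr1n.
  have LM : legendre (- M%:Z) r = 1.
    rewrite -Xr /X chi_r // exprM -chi4E // -mulN1r legendreM // legendreN1 // -chi4E //.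
    have c4k : chi4 r ^+ n./2 * chi4 r ^+ n./2 = 1 by rewrite -exprD addnn -mul2n exprM c4 expr1n.
    rewrite /f /k /n; move: c4k; rewrite /n; case: ifP => eM c4k.
      rewrite (_ : _ * chi4 r ^+ M./2 * _ = chi4 r * legendre M r * (chi4 r ^+ M./2 * chi4 r ^+ M./2)); last by ring.
      by rewrite c4k mulr1.
    have -> : M%:Z = 2 * M./2%:Z by rewrite -{1}(odd_double_half M) eM -mul2n PoszM.
    rewrite legendreM // legendre2 // -chi8E // exprSr.
    rewrite (_ : chi8 r * _ * _ = chi4 r * chi8 r * legendre M./2 r * (chi4 r ^+ M./2./2 * chi4 r ^+ M./2./2)); last by ring.
    by rewrite c4k mulr1 mulrA.
  have [j] := legendre_square pr or LM; rewrite opprK => dj; exists j.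
  by move: dj; have -> : j%:Z ^+ 2 + M%:Z = (j ^ 2 + M)%N%:Z by rewrite -mulnn expr2 PoszD PoszM.
have n0 : (0 < n)%N by apply: odd_gt0.
have cop8 : coprime 8 n by rewrite (_ : 8 = 2 ^ 3)%N // coprime_pexpl // coprime2n.
have crt c r : exists u, (u %% 8 = c %% 8)%N /\ u = r %[mod n].
  by exists (chinese 8 n c r); rewrite chinese_modl // chinese_modr.
have MQ8 : (1 < 8 * n)%N by lia.
have M8 : (M %% 8 < 8)%N by rewrite ltn_mod.
case: (boolP (odd M)) => oM.
  have nM : n = M by rewrite /n oM.
  have oM8 : odd (M %% 8) by rewrite odd_mod8.
  case: (boolP (M %% 8 == 3)%N) => M3.
    have [u [u8 un]] := crt 1%N (M./2).
    have M2 : (M %| (2 * u).+1)%N.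
      rewrite /dvdn -addn1 -modnDml -modnMmr -nM un modnMmr modnDml nM.
      have := odd_double_half M; rewrite oM => E.
      by rewrite (_ : 2 * M./2 + 1 = M)%N ?modnn //; lia.
    exists (8 * n)%N, X, u, 2%N; split; [split=> // | by split]; last by right.
    have c4u : chi4 u = 1 by rewrite chi4_mod8 u8.
    have : chi 2%N * chi u = chi4 n by rewrite -(rcM rchi) chi_N1 // nM.
    rewrite chi_2 /X /f oM c4u expr1n !mul1r.
    rewrite chi4_mod8 chi8_mod8 nM (eqP M3) /chi8 /chi4 /=; lia.
  have M41 : (M %% 4 = 1)%N.
    rewrite -mod8_mod4; move: oM8 M3 M7 M8.
    by case: (M %% 8)%N => [|[|[|[|[|[|[|[|?]]]]]]]].
  have [u [u8 un]] := crt 1%N M.-1.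
  have M1 : (M %| (1 * u).+1)%N.
    by rewrite /dvdn mul1n -addn1 -modnDml -nM un modnDml nM addn1 prednK // modnn.
  exists (8 * n)%N, X, u, 1%N; split; [split=> // | by split]; last by left.
  have c4u : chi4 u = 1 by rewrite chi4_mod8 u8.
  rewrite /X /f oM c4u expr1n !mul1r chi_N1; last by rewrite nM -(mul1n u).
  by rewrite /chi4 nM oM M41.
have ME : M = n.*2 by rewrite /n (negbTE oM) -[LHS]odd_double_half (negbTE oM).
have [u [u8 un]] := crt (if n %% 4 == 1 then 1 else 5)%N n.-1.
have nu : (n %| u.+1)%N.
  by rewrite /dvdn -addn1 -modnDml un modnDml addn1 prednK // modnn.
have ou : odd u by rewrite -odd_mod8 u8; case: ifP.
exists (8 * n)%N, X, u, 1%N; split; [split=> // | split=> //]; last first.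
- rewrite mul1n ME -mul2n Gauss_dvd ?nu ?dvdn2 /= ?ou //.
  by rewrite coprime2n.
- by left.
have c4u : chi4 u = 1 by rewrite chi4_mod8 u8; case: ifP.
rewrite /X /f (negbTE oM) c4u expr1n mulr1 chi_N1 //.
by rewrite chi8_mod8 u8 /chi4 on; case: ifP.
Qed.

(** * Products of split primes *)

Section SplitProducts.
Variables (Q : nat) (chi : nat -> int).
Hypotheses (Q1 : (1 < Q)%N) (rchi : real_character Q chi).

Local Notation gT := {unit 'Z_Q}.

Definition residue_unit (n : nat) : gT := insubd (1%g : gT) (n%:R : 'Z_Q).

Lemma residue_unitE n : coprime n Q -> val (residue_unit n) = n%:R :> 'Z_Q.
Proof. by move=> c; rewrite /residue_unit insubdK // unfold_in /= unitZpE // coprime_sym. Qed.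

Lemma residue_unitM a b : coprime a Q -> coprime b Q ->
  residue_unit (a * b) = (residue_unit a * residue_unit b)%g.
Proof.
move=> ca cb; apply/val_inj; rewrite residue_unitE ?coprimeMl ?ca //=.
by rewrite !residue_unitE // natrM.
Qed.

Lemma Zp_nat_eq a b : (a%:R == b%:R :> 'Z_Q) = (a == b %[mod Q]).
Proof. by rewrite -val_eqE /= !val_Zp_nat. Qed.

Lemma unit_mulC (x y : gT) : (x * y = y * x)%g.
Proof. by apply/val_inj; rewrite /= mulrC. Qed.

Lemma unit_subnorm (A B : {set gT}) : (A \subset 'N(B))%g.
Proof. by apply: cents_norm; apply/centsP => y _ z _; apply: unit_mulC. Qed.

(** Among the subgroups containing H but not x, a maximal one K has index 2: K and any y
    outside K generate x, so xy lies in K because y^2 does.  Then psi is 1 on K and -1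
    off K. *)
Lemma separating_character (H : {group gT}) (x : gT) :
  (forall y, y ^+ 2 \in H)%g -> x \notin H ->
  exists psi, [/\ real_character Q psi,
    forall n, coprime n Q -> residue_unit n \in H -> psi n = 1 &
    forall n, coprime n Q -> residue_unit n = x -> psi n = -1].
Proof.
move=> sqH xH.
have [K /maxgroupP [/andP [HK xK] maxK] _] :
    {K : {group gT} | [max K | H \subset K & x \notin K]%g & H \subset K}.
  by apply: maxgroup_exists; rewrite subxx.
have sqK y : (y ^+ 2)%g \in K by apply: (subsetP HK).
have coset y : y \notin K -> (x * y)%g \in K.
  move=> yK; have [xKy|nx] := boolP (x \in (K <*> <[y]>)%G); last first.
    case/negP: yK; rewrite -(maxK (K <*> <[y]>)%G _ (joing_subl _ _)).
      by rewrite (subsetP (joing_subr _ _)) // cycle_id.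
    by rewrite nx (subset_trans HK) ?joing_subl.
  have evenK j : ~~ odd j -> (y ^+ j)%g \in K.
    by move=> ej; rewrite -[j]odd_double_half (negbTE ej) add0n -mul2n expgM groupX.
  move: xKy xK; rewrite /= norm_joinEr ?unit_subnorm // => /mulsgP [k _ kK /cycleP [i ->] ->].
  rewrite groupMl // => yi; rewrite -mulgA groupMl // -expgSr evenK //= negbK.
  by apply: contraR yi => /evenK.
pose psi n : int := if coprime n Q then if residue_unit n \in K then 1 else -1 else 0.
exists psi; split.
- split.
  + move=> a b; rewrite /psi coprimeMl.
    have [ca|] := boolP (coprime a Q); last by rewrite mul0r.
    have [cb|] := boolP (coprime b Q); last by rewrite mulr0.
    rewrite /= residue_unitM //.
    have [aK|aK] := boolP (residue_unit a \in K); first by rewrite groupMl // mul1r.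
    have [bK|bK] := boolP (residue_unit b \in K); first by rewrite groupMr // (negbTE aK).
    rewrite mulN1r opprK.
    have := groupM (coset _ aK) (coset _ bK).
    have -> : (x * residue_unit a * (x * residue_unit b) =
               x ^+ 2 * (residue_unit a * residue_unit b))%g.
      by rewrite expgS expg1 -!mulgA; congr (_ * _)%g; rewrite !mulgA; congr (_ * _)%g; apply: unit_mulC.
    by rewrite groupMl // => ->.
  + move=> a; rewrite /psi /residue_unit natrD char_Zp // addr0.
    by rewrite -coprime_modl modnDr coprime_modl.
  + by move=> a ca; rewrite /psi ca; case: ifP; [left|right].
  + by move=> a ca; rewrite /psi (negbTE ca).
- by move=> n cn nH; rewrite /psi cn (subsetP HK).
- by move=> n cn nx; rewrite /psi cn nx (negbTE xK).
Qed.

(** Up to squares, because a real character cannot tell a square from 1. *)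
Definition split_represented (y : gT) : Prop := exists q t,
  [/\ (0 < q)%N, forall r, prime r -> (r %| q)%N -> chi r = 1 &
      val y = q%:R * t%:R ^+ 2 :> 'Z_Q].

Lemma split_representedM y z : split_represented y -> split_represented z ->
  split_represented (y * z)%g.
Proof.
case=> q [t [q0 qs qE]] [q' [t' [q0' qs' qE']]].
exists (q * q')%N, (t * t')%N; split.
- by rewrite muln_gt0 q0.
- by move=> r pr; rewrite Euclid_dvdM // => /orP [/qs|/qs'] ->.
- by rewrite /= qE qE' !natrM; ring.
Qed.

(** A group of represented classes which contains the squares but not u can be enlarged: a
    character psi separates it from u, and a prime p where psi and psi chi are both -1 has
    chi p = 1 and lies outside the group. *)
Lemma split_representation u : chi u = 1 -> exists q t,
  [/\ (0 < q)%N, forall r, prime r -> (r %| q)%N -> chi r = 1 &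
     u = q * t ^ 2 %[mod Q]].
Proof.
move=> chiu.
have cu : coprime u Q by apply/negPn/negP => /(rc_zero rchi); rewrite chiu.
have step (H : {group gT}) : (forall y, y ^+ 2 \in H)%g ->
    (forall y, y \in H -> split_represented y) ->
    residue_unit u \notin H -> exists2 H' : {group gT}, H \proper H' &
      (forall y, y \in H' -> split_represented y).
  move=> sqH rH uH.
  have [psi [rpsi psi1 psiN]] := separating_character sqH uH.
  have rpsichi := rc_mul_exp 1 rpsi rchi.
  have psiu := psiN _ cu erefl.
  have [|p [pp psip psichip]] := two_characters_common_N1 (ltnW Q1) rpsi rpsichi psiu (_ : _ u = -1).
    by rewrite psiu chiu mulr1.
  have cp : coprime p Q by apply/negPn/negP => /(rc_zero rpsi); rewrite psip.
  have chip : chi p = 1 by move: psichip; rewrite psip expr1 mulN1r => /oppr_inj.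
  have pH : residue_unit p \notin H.
    by apply/negP => /(psi1 _ cp); rewrite psip.
  exists (H <*> <[residue_unit p]>)%G.
    rewrite properE joing_subl /=; apply: contra pH => /subsetP; apply.
    by rewrite (subsetP (joing_subr _ _)) // cycle_id.
  move=> y; rewrite /= norm_joinEr ?unit_subnorm // => /mulsgP [k _ /rH rk /cycleP [i ->] ->].
  apply: split_representedM rk _; exists (p ^ i)%N, 1%N; split.
  - by rewrite expn_gt0 prime_gt0.
  - move=> r pr; rewrite Euclid_dvdX // => /andP [].
    by rewrite dvdn_prime2 // => /eqP ->.
  - by rewrite expr1n mulr1 FinRing.val_unitX natrX residue_unitE.
have squares_group : group_set [set y ^+ 2 | y in [set: gT]]%g.
  apply/group_setP; split; first by apply/imsetP; exists 1%g; rewrite ?expg1n.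
  move=> _ _ /imsetP [y _ ->] /imsetP [z _ ->]; apply/imsetP; exists (y * z)%g => //.
  by rewrite expgMn //; apply: unit_mulC.
have reached n : forall H : {group gT}, (#|[set: gT]| - #|H| <= n)%N ->
    (forall y, y ^+ 2 \in H)%g -> (forall y, y \in H -> split_represented y) ->
    split_represented (residue_unit u).
  elim: n => [|n IHn] H Hn sqH rH; have [/rH //|uH] := boolP (residue_unit u \in H).
    case/negP: uH; have /eqP -> : H == [set: gT] :> {set gT}; last by rewrite inE.
    by rewrite eqEcard subsetT /= -subn_eq0 -leqn0.
  have [H' HH' rH'] := step H sqH rH uH; apply: (IHn H') => //.
    have lt := proper_card HH'.
    have le : (#|H'| <= #|[set: gT]|)%N by rewrite subset_leq_card ?subsetT.
    by rewrite -ltnS; apply: leq_trans Hn; apply: ltn_sub2l => //; apply: leq_trans lt le.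
  by move=> y; apply: (subsetP (proper_sub HH')).
have [||q [t [q0 qs qE]]] := reached _ (Group squares_group) (leqnn _).
- by move=> y; apply/imsetP; exists y.
- move=> _ /imsetP [y _ ->].
  exists 1%N, (val y : nat); split=> //.
    by move=> r pr; rewrite dvdn1 => /eqP r1; rewrite r1 in pr.
  by rewrite natr_Zp mul1r FinRing.val_unitX.
exists q, t; split => //; apply/eqP; rewrite -Zp_nat_eq natrM natrX -qE residue_unitE //.
Qed.
End SplitProducts.

Lemma linear_congruence r a e : (0 < r)%N -> coprime r a ->
  exists k, (r %| e + a * k)%N.
Proof.
move=> r0 /eqP cra; have [x _] := Bezoutl a r0; rewrite cra => rx.
by exists (x * e)%N; rewrite mulnA (mulnC a) -{1}(mul1n e) -mulnDl dvdn_mulr.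
Qed.

(** Adjoin the primes r of q one at a time.  If r already divides the part q' treated so far,
    the root lifts as in Hensel's lemma, 2h being invertible modulo r; otherwise the Chinese
    remainder theorem applies. *)
Lemma sqrt_mod_composite M q : (0 < q)%N ->
  (forall r, prime r -> (r %| q)%N ->
     odd r /\ ~~ (r %| M)%N /\ exists k : nat, (r %| k ^ 2 + M)%N) ->
  exists h : nat, (q %| h ^ 2 + M)%N.
Proof.
move: q; apply: (@prime_mul_ind (fun q => _ -> exists h : nat, (q %| h ^ 2 + M)%N)).
  by move=> _; exists 0%N; rewrite dvd1n.
move=> r q pr q0 IHq split_rq; have r0 := prime_gt0 pr.
have [|h /dvdnP [e hE]] := IHq.
  by move=> s ps sq; apply: split_rq; rewrite ?dvdn_mull.
have [|or [rM [j rj]]] := split_rq r pr; first by rewrite dvdn_mulr.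
have expand k : ((h + q * k) ^ 2 + M = q * (e + 2 * h * k + q * k ^ 2))%N.
  have -> : ((h + q * k) ^ 2 + M = h ^ 2 + M + q * (2 * h * k + q * k ^ 2))%N by ring.
  by rewrite hE; ring.
have [rq|rq] := boolP (r %| q)%N.
  have c2h : coprime r (2 * h).
    rewrite coprimeMr coprimen2 or prime_coprime //=; apply: contra rM => rh.
    have : (r %| h ^ 2 + M)%N by rewrite hE dvdn_mull.
    by rewrite dvdn_addr // dvdn_mulr.
  have [k rk] := linear_congruence e r0 c2h.
  exists (h + q * k)%N; rewrite expand mulnC dvdn_pmul2l // .
  by rewrite dvdn_add // dvdn_mulr.
rewrite -prime_coprime // in rq.
have [k rk] := linear_congruence (h + r.-1 * j) r0 rq.
exists (h + q * k)%N; rewrite Gauss_dvd //; apply/andP; split; last by rewrite expand dvdn_mulr.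
have hj : (h + q * k = j %[mod r])%N.
  rewrite -[j in RHS]addn0 -(modnMDl j (h + q * k)).
  have -> : (j * r + (h + q * k) = j + (h + r.-1 * j + q * k))%N by rewrite -{1}(prednK r0); ring.
  by rewrite -modnDmr (eqP rk).
by rewrite /dvdn -modnDml -modnXm hj modnXm modnDml.
Qed.

(** These congruences are what is needed to complete a binary form to a ternary one
    of given determinant.  When the factor 2 occurs in c, M is odd and h is taken odd. *)
Theorem reciprocal_divisors M : (0 < M)%N -> ~~ (4 %| M)%N -> (M %% 8 != 7)%N ->
  exists c t h, [/\ (0 < c)%N, (M %| c * t ^ 2 + 1)%N & (c %| h ^ 2 + M)%N].
Proof.
move=> M0 M4 M7.
have [Q [chi [u [s [[Q1 rchi chiu MQ sP] [Mu split_chi]]]]]] := kronecker_character M0 M4 M7.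
have [q [t [q0 qs ut]]] := split_representation Q1 rchi chiu.
have [h qh] : exists h : nat, (q %| h ^ 2 + M)%N.
  by apply: sqrt_mod_composite => // r pr /(qs _ pr) /(split_chi _ pr).
exists (s * q)%N, t.
have Mt : (M %| s * q * t ^ 2 + 1)%N.
  have utM : (u = q * t ^ 2 %[mod M]) by rewrite -(modn_dvdm u MQ) ut modn_dvdm.
  by rewrite -mulnA /dvdn -modnDml -modnMmr -utM modnMmr modnDml addn1.
case: sP Mt {Mu} => [-> Mt|[-> oM] Mt]; first by exists h; rewrite mul1n in Mt *; split.
have oq : odd q.
  apply: contraT => eq; have /(split_chi _ (isT : prime 2)) [] // : chi 2%N = 1.
  by apply: qs => //; rewrite dvdn2.
have [h' oh' qh'] : exists2 h', odd h' & (q %| h' ^ 2 + M)%N.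
  case: (boolP (odd h)) => oh; first by exists h.
  exists (h + q)%N; first by rewrite oddD (negbTE oh) oq.
  have -> : ((h + q) ^ 2 + M = h ^ 2 + M + q * (2 * h + q))%N by ring.
  by rewrite dvdn_add // dvdn_mulr.
exists h'; split; rewrite ?muln_gt0 //.
by rewrite Gauss_dvd ?coprime2n // qh' dvdn2 oddD oddX oh' oM.
Qed.

(** * Ternary forms of determinant 3 *)

Definition ternary (a b c d e f x y z : int) : int :=
  a * x ^+ 2 + b * y ^+ 2 + c * z ^+ 2 + 2 * d * y * z + 2 * e * x * z + 2 * f * x * y.

Definition represents (Q : int -> int -> int -> int) (n : int) : Prop :=
  exists x y z, n = Q x y z.

Lemma lt_natz (x : int) : exists n : nat, x < n%:Z.
Proof. by exists (absz x).+1; lia. Qed.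

Lemma int_euclid (x d : int) : 0 < d -> exists q r, x = q * d + r /\ 0 <= r < d.
Proof.
move=> d0; exists (x %/ d)%Z, (x %% d)%Z; split; first exact: divz_eq.
by rewrite ltz_pmod // modz_ge0 // gt_eqF.
Qed.

Lemma nearest_multiple (a f : int) : 0 < a -> exists k, - a <= 2 * (f + k * a) <= a.
Proof.
move=> a0; have [|q [r [E r_range]]] := @int_euclid (2 * f + a) (2 * a); first by lia.
by exists (- q); nia.
Qed.

Definition reducible (F : int -> int -> int -> int) : Prop :=
  exists b c d : int,
   [/\ b * c - d ^+ 2 = 3, - b <= 2 * d <= b, 0 < b <= c &
    forall n, represents F n -> represents (ternary 1 b c d 0 0) n].

Lemma reducible_trans F F' : (forall x y z, represents F' (F x y z)) ->
  reducible F' -> reducible F.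
Proof.
move=> FF' [b [c [d [h1 h2 h3 h4]]]]; exists b, c, d; split=> // n [x [y [z ->]]].
by apply: h4.
Qed.

Definition ternary_det (a b c d e f : int) : int :=
  a * b * c + 2 * d * e * f - a * d ^+ 2 - b * e ^+ 2 - c * f ^+ 2.

(** Hermite's inequality: g and h are the diagonal coefficients, and k the off-diagonal one,
    of the binary form a F - (first linear form)^2, whose determinant is 3a.  Both reductions
    together give 9 a^3 <= 64. *)
Lemma hermite_bound (a b f g h k : int) : 0 < a -> 0 < g -> g = a * b - f ^+ 2 ->
  - a <= 2 * f <= a -> a <= b -> g <= h -> g * h - k ^+ 2 = 3 * a -> - g <= 2 * k <= g ->
  a = 1.
Proof.
move=> a0 g0 gE fa ab gh adj kg.
have k2 : 0 <= (g - 2 * k) * (g + 2 * k) by apply: mulr_ge0; lia.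
have f2 : 0 <= (a - 2 * f) * (a + 2 * f) by apply: mulr_ge0; lia.
have g2 : g ^+ 2 <= 4 * a.
  by have : g * g <= g * h by [rewrite ler_pM2l]; lia.
have a2 : 3 * a ^+ 2 <= 4 * g.
  by have : a * a <= a * b by [rewrite ler_pM2l]; lia.
have ag : 3 * (a * g) <= 16.
  rewrite -(ler_pM2l a0).
  have : 3 * a ^+ 2 * g <= 4 * g * g by rewrite ler_pM2r.
  by lia.
have [//|a_ge2] : a = 1 \/ 2 <= a by lia.
have : 2 * 2 <= a * a by apply: ler_pM.
have : 2 * g <= a * g by rewrite ler_pM2r.
by lia.
Qed.

(** Descent on a and then on the minor ab - f^2.  A translation x + ky makes |2f| <= a, and
    b < a allows an exchange which decreases a; a translation y + kz reduces the adjoint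
    binary form, and an exchange of y and z decreases its first coefficient ab - f^2. *)
Lemma ternary_reduction (a b c d e f : int) :
  0 < a -> 0 < a * b - f ^+ 2 -> ternary_det a b c d e f = 3 ->
  reducible (ternary a b c d e f).
Proof.
have [A le_A] : exists A : nat, a < A%:Z by apply: lt_natz.
elim: A a b c d e f le_A => [|A IHA] a b c d e f le_A a0; first by lia.
have [G] : exists G : nat, a * b - f ^+ 2 < G%:Z by apply: lt_natz.
elim: G b c d e f => [|G IHG] b c d e f le_G g0 det3; first by lia.
have [k fk] := nearest_multiple f a0.
set f1 := f + k * a in fk; pose b1 := b + 2 * k * f + k ^+ 2 * a; pose d1 := d + k * e.
have gE : a * b1 - f1 ^+ 2 = a * b - f ^+ 2 by rewrite /b1 /f1; ring.
have detE : ternary_det a b1 c d1 e f1 = 3 by rewrite -det3 /ternary_det /b1 /f1 /d1; ring.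
apply: (@reducible_trans _ (ternary a b1 c d1 e f1)).
  move=> x y z; exists (x - k * y), y, z; rewrite /ternary /b1 /f1 /d1; ring.
move: b1 d1 f1 fk gE detE => b1 d1 f1 fk gE detE.
rewrite -{}gE in le_G g0; clear b d f k det3.
have [b1a|ab1] := ltP b1 a.
  apply: (@reducible_trans _ (ternary b1 a c e d1 f1)).
    by move=> x y z; exists y, x, z; rewrite /ternary; ring.
  apply: IHA; [by lia | by nia | by rewrite mulrC |].
  by rewrite -detE /ternary_det; ring.
have [k gk] := nearest_multiple (a * d1 - e * f1) g0.
pose c2 := c + 2 * k * d1 + k ^+ 2 * b1; pose d2 := d1 + k * b1; pose e2 := e + k * f1.
have g12E : a * d1 - e * f1 + k * (a * b1 - f1 ^+ 2) = a * d2 - e2 * f1.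
  by rewrite /d2 /e2; ring.
rewrite {}g12E in gk.
have {}detE : ternary_det a b1 c2 d2 e2 f1 = 3 by rewrite -detE /ternary_det /c2 /e2 /d2; ring.
apply: (@reducible_trans _ (ternary a b1 c2 d2 e2 f1)).
  move=> x y z; exists x, (y - k * z), z; rewrite /ternary /c2 /e2 /d2; ring.
move: c2 d2 e2 gk detE => c2 d2 e2 gk detE; clear c d1 e k.
have adj : (a * b1 - f1 ^+ 2) * (a * c2 - e2 ^+ 2) - (a * d2 - e2 * f1) ^+ 2 = a * 3.
  by rewrite -detE /ternary_det; ring.
have [h22|h22] := ltP (a * c2 - e2 ^+ 2) (a * b1 - f1 ^+ 2).
  apply: (@reducible_trans _ (ternary a c2 b1 d2 f1 e2)).
    by move=> x y z; exists x, z, y; rewrite /ternary; ring.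
  apply: IHG; [by lia | by nia |].
  by rewrite -detE /ternary_det; ring.
have a1 : a = 1 by apply: (hermite_bound a0 g0 erefl fk ab1 h22 _ gk); lia.
subst a; have f10 : f1 = 0 by lia.
subst f1; exists b1, (c2 - e2 ^+ 2), d2; split.
- by rewrite -detE /ternary_det; ring.
- by lia.
- by lia.
- move=> n [x [y [z ->]]]; exists (x + e2 * z), y, z.
  by rewrite /ternary; ring.
Qed.

(** The binary part bc - d^2 = 3 left by the reduction has b = 1, or b = 2 and d odd. *)
Theorem ternary_det3 (a b c d e f : int) :
  0 < a -> 0 < a * b - f ^+ 2 -> ternary_det a b c d e f = 3 ->
  (forall n, represents (ternary a b c d e f) n ->
     represents (fun x y z => x ^+ 2 + y ^+ 2 + 3 * z ^+ 2) n) \/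
  (forall n, represents (ternary a b c d e f) n ->
     represents (fun x y z => x ^+ 2 + 2 * (y ^+ 2 + y * z + z ^+ 2)) n).
Proof.
move=> a0 g0 /(ternary_reduction a0 g0) [b' [c' [d' [det le_d le_bc sub]]]].
have b2 : b' <= 2 by nia.
have [[b1 d1]|[b1 [d1|d1]]] : (b' = 1 /\ d' = 0) \/ (b' = 2 /\ (d' = 1 \/ d' = -1)).
- have : b' = 1 \/ b' = 2 by lia.
  case=> bE; subst b'; first by left; lia.
  have : d' = 0 \/ d' = 1 \/ d' = -1 by lia.
  by case=> [dE|dE]; [subst d'; lia | right].
- left=> n /sub [x [y [z ->]]]; exists x, y, z; subst b' d'.
  have -> : c' = 3 by lia.
  by rewrite /ternary; ring.
- right=> n /sub [x [y [z ->]]]; exists x, y, z; subst b' d'.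
  have -> : c' = 2 by lia.
  by rewrite /ternary; ring.
- right=> n /sub [x [y [z ->]]]; exists x, y, (- z); subst b' d'.
  have -> : c' = 2 by lia.
  by rewrite /ternary; ring.
Qed.

Lemma square_mod3 (x : int) : (exists q, x = 3 * q) \/ (exists q, x ^+ 2 = 3 * q + 1).
Proof.
have [//|q [r [xE r3]]] := @int_euclid x 3.
have [rE|[rE|rE]] : r = 0 \/ r = 1 \/ r = 2 by lia.
- by left; exists q; lia.
- by right; exists (3 * q ^+ 2 + 2 * q); rewrite xE rE; ring.
- by right; exists (3 * q ^+ 2 + 4 * q + 1); rewrite xE rE; ring.
Qed.

(** With c t^2 + 1 = 3Nd and c k = (hd)^2 + d, the form with rows (3k, 3hd, t), (3hd, 3c, 0),
    (t, 0, N) has determinant 3.  It represents N and 3c; as c = 2 modulo 3, the latter is not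
    of the form x^2 + y^2 + 3z^2. *)
Theorem represented_by_A2 (N : nat) : (0 < N)%N -> ~~ (4 %| N)%N -> (N %% 8 != 5)%N ->
  represents (fun x y z => x ^+ 2 + 2 * (y ^+ 2 + y * z + z ^+ 2)) N%:Z.
Proof.
move=> N0 N4 N8.
have [c [t [h [c0 /dvdnP [d dE] /dvdnP [l lE]]]]] : exists c t h,
    [/\ (0 < c)%N, (3 * N %| c * t ^ 2 + 1)%N & (c %| h ^ 2 + 3 * N)%N].
  by apply: reciprocal_divisors; [lia | lia | lia].
have c3 : (c %% 3 = 2)%N.
  have : ((c * t ^ 2 + 1) %% 3 = 0)%N by apply/eqP; rewrite dE mulnCA modnMr.
  rewrite -modnDml -modnMm -modnXm modnDml.
  have := ltn_pmod c (isT : 0 < 3)%N; have := ltn_pmod t (isT : 0 < 3)%N.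
  by case: (c %% 3)%N => [|[|[|?]]]; case: (t %% 3)%N => [|[|[|?]]].
have dI : c%:Z * t%:Z ^+ 2 = d%:Z * (3 * N%:Z) - 1 by lia.
have lI : h%:Z ^+ 2 + 3 * N%:Z = l%:Z * c%:Z by lia.
have d0 : 0 < d%:Z by case: (d) dE => // ; lia.
move: (h%:Z) (t%:Z) (d%:Z) (l%:Z) dI lI d0 => H T D L dI lI d0 {dE lE h t d l}.
pose k := L * D ^+ 2 - D * T ^+ 2.
have kE : c%:Z * k = (H * D) ^+ 2 + D.
  have -> : c%:Z * k = (L * c%:Z) * D ^+ 2 - D * (c%:Z * T ^+ 2) by rewrite /k; ring.
  by rewrite -lI dI; ring.
have k0 : 0 < 3 * k.
  rewrite pmulr_rgt0 // -(pmulr_rgt0 _ (c0 : 0 < c%:Z)) kE.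
  by rewrite ltr_wpDl // sqr_ge0.
case: (@ternary_det3 (3 * k) (3 * c%:Z) N%:Z 0 T (3 * (H * D)) k0).
- have -> : 3 * k * (3 * c%:Z) - (3 * (H * D)) ^+ 2 = 9 * (c%:Z * k - (H * D) ^+ 2) by ring.
  by rewrite kE; lia.
- have -> : ternary_det (3 * k) (3 * c%:Z) N%:Z 0 T (3 * (H * D)) =
      9 * N%:Z * (c%:Z * k) - 3 * (c%:Z * T ^+ 2) - 9 * N%:Z * (H * D) ^+ 2.
    by rewrite /ternary_det; ring.
  by rewrite kE dI; ring.
- move=> sub.
  have [x [y [z E]]] : represents (fun x y z => x ^+ 2 + y ^+ 2 + 3 * z ^+ 2) (3 * c%:Z).
    by apply: sub; exists 0, 1, 0; rewrite /ternary; ring.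
  have [q cE] : exists q : int, c%:Z = 3 * q + 2 by exists (c %/ 3)%N; clear -c3; lia.
  clear -E cE.
  have [[x' xE]|[x' xE]] := square_mod3 x; have [[y' yE]|[y' yE]] := square_mod3 y; try lia.
  have [[z' zE]|[z' zE]] := square_mod3 z; subst x y; last by lia.
  by subst z; lia.
- by apply; exists 0, 0, 1; rewrite /ternary; ring.
Qed.

(** One of y, z, y + z is even. *)
Lemma A2_diagonal y z : exists w b : int, y ^+ 2 + y * z + z ^+ 2 = w ^+ 2 + 3 * b ^+ 2 :> int.
Proof.
have parity (u : int) : exists q, u = 2 * q \/ u = 2 * q + 1.
  by have [//|q [r [uE r2]]] := @int_euclid u 2; exists q; lia.
have [p [->|->]] := parity y; first by exists (z + p), p; ring.
have [q [->|->]] := parity z; first by exists (2 * p + 1 + q), q; ring.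
by exists (p - q), (p + q + 1); ring.
Qed.

(** * From the ternary form to points of the plane x + y + 2z = s^2 *)

Lemma mod3_balanced (x : int) : exists q e : int, [/\ x = 3 * q + e & e \in [:: 0; 1; -1]].
Proof.
have [//|q [r [xE r3]]] := @int_euclid x 3.
have [rE|[rE|rE]] : r = 0 \/ r = 1 \/ r = 2 by lia.
- by exists q, 0; split; rewrite ?inE ?eqxx ?orbT //; lia.
- by exists q, 1; split; rewrite ?inE ?eqxx ?orbT //; lia.
- by exists (q + 1), (-1); split; rewrite ?inE ?eqxx ?orbT //; lia.
Qed.

Lemma mod3_up_to_sign (x : int) : exists q e f : int,
  [/\ e * x = 3 * q + f, e ^+ 2 = 1 & f = 0 \/ f = 1].
Proof.
have [q [e [-> ]]] := mod3_balanced x; rewrite !inE => /or3P [] /eqP ->.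
- by exists q, 1, 0; split; [ring | ring | left].
- by exists q, 1, 1; split; [ring | ring | right].
- by exists (- q), (-1), 1; split; [ring | ring | right].
Qed.

(** If 3 divides A and W, the conclusion is immediate.  Otherwise let A = 2W + 3k and W = 1
    modulo 3 after changes of sign.  The rational substitution a = (k + 2b)/3, w = b - a,
    B = W + k is integral when k = b modulo 3.  As n is not 1 modulo 3, a change of sign of b
    ensures this, unless b = 0 and k = 1 modulo 3; in that case multiplication of
    A + W sqrt(-2) by (-1 + 2 sqrt(-2))/3, of norm 1, makes both coordinates divisible
    by 3. *)
Lemma divide_out_3 (n A W b : int) : 3 * n = A ^+ 2 + 2 * W ^+ 2 + 6 * b ^+ 2 ->
  (forall q, n <> 3 * q + 1) ->
  exists B a w : int, n = 2 * B ^+ 2 + 3 * a ^+ 2 + 6 * w ^+ 2.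
Proof.
have [p [e [f [Ap e2 fP]]]] := mod3_up_to_sign A.
have [q [e' [f' [Wq e'2 f'P]]]] := mod3_up_to_sign W.
have [r [e'' [f'' [br e''2 f''P]]]] := mod3_up_to_sign b.
have -> : A ^+ 2 = (e * A) ^+ 2 by rewrite exprMn e2 mul1r.
have -> : W ^+ 2 = (e' * W) ^+ 2 by rewrite exprMn e'2 mul1r.
have -> : b ^+ 2 = (e'' * b) ^+ 2 by rewrite exprMn e''2 mul1r.
rewrite {}Ap {}Wq {}br {A W b e2 e'2 e''2 e e' e''} => E n1.
case: fP f'P => fE [] fE'; subst f f'; try lia.
  by exists (3 * r + f''), p, q; lia.
(* After the sign changes -A = 2W + 3k. *)
pose W := 3 * q + 1; pose k := - p - 2 * q - 1.
have {}E : n = 2 * W ^+ 2 + 4 * W * k + 3 * k ^+ 2 + 2 * (3 * r + f'') ^+ 2.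
  by rewrite /W /k; lia.
have good b a : b ^+ 2 = (3 * r + f'') ^+ 2 -> k = 3 * a - 2 * b ->
    exists B a w : int, n = 2 * B ^+ 2 + 3 * a ^+ 2 + 6 * w ^+ 2.
  move=> b2 kE; exists (W + k), a, (b - a); rewrite E -b2 kE; ring.
have [l [g [kE]]] := mod3_balanced k; rewrite !inE => /or3P gP.
case: f''P gP => fE; subst f'' => -[] /eqP gE; subst g.
- by apply: (good (3 * r) (l + 2 * r)); [ring | lia].
- exists (3 * r), (2 * q + l + 1), (q + 2 * l + 1); rewrite E /W kE; ring.
- by case: (n1 (6 * q ^+ 2 + 4 * q + (4 * q * (3 * l - 1) + 4 * l) + (3 * l - 1) ^+ 2 + 6 * r ^+ 2 - 1)); rewrite E /W kE; ring.
- by case: (n1 (6 * q ^+ 2 + 4 * q + (4 * q * (3 * l) + 4 * l) + (3 * l) ^+ 2 + 6 * r ^+ 2 + 4 * r + 1)); rewrite E /W kE; ring.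
- by apply: (good (3 * r + 1) (l + 2 * r + 1)); [ring | lia].
- by apply: (good (- (3 * r + 1)) (l - 2 * r - 1)); [ring | lia].
Qed.

(** The equation modulo 2 and 3 gives a = L modulo 2 and B^2 = L^2 modulo 3. *)
Lemma four_squares_on_plane (m L B a w : int) :
  6 * m - L ^+ 2 = 2 * B ^+ 2 + 3 * a ^+ 2 + 6 * w ^+ 2 ->
  exists x y z : int, x + y + 2 * z = L /\ m = x ^+ 2 + y ^+ 2 + z ^+ 2 + w ^+ 2.
Proof.
move=> E.
have [e eE] : exists e : int, L + a = 2 * e.
  have [//|q [r [qE r2]]] := @int_euclid (L + a) 2; exists q.
  have [rE|rE] : r = 0 \/ r = 1 by lia.
    by lia.
  have aE : a = q * 2 + 1 - L by lia.
  by exfalso; subst a; lia.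
have [z [s [s2 zE]]] : exists z s : int, s ^+ 2 = 1 /\ s * B = L - 3 * z.
  have [q [f [LE]]] := mod3_balanced L; have [r [g [BE]]] := mod3_balanced B; subst L B.
  rewrite !inE => /or3P gP /or3P fP.
  case: gP fP => /eqP gE [] /eqP fE; subst f g; try (exfalso; lia).
  - by exists (q - r), 1; split; lia.
  - by exists (q - r), 1; split; lia.
  - by exists (q + r), (-1); split; lia.
  - by exists (q + r), (-1); split; lia.
  - by exists (q - r), 1; split; lia.
exists (e - z), (L - z - e), z; split; first by ring.
have B2 : B ^+ 2 = (L - 3 * z) ^+ 2 by rewrite -zE exprMn s2 mul1r.
have aE : a = 2 * e - L by clear -eE; lia.
have E6 : 6 * m = 6 * ((e - z) ^+ 2 + (L - z - e) ^+ 2 + z ^+ 2 + w ^+ 2).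
  by rewrite -[6 * m](subrK (L ^+ 2)) E B2 aE; ring.
by clear -E6; lia.
Qed.

Definition thirds_representable (m : nat) : Prop := exists x y z w t : nat,
  (9 * m = 9 * x ^ 2 + y ^ 2 + z ^ 2 + w ^ 2 /\ 3 * x + y + 2 * z = 3 * t ^ 2)%N.

(** Assume y <= x and 0 <= w.  If x were negative, then 2z > t^2 and z^2 > m; if z were
    negative, then x + y > t^2 and x^2 + y^2 > 2m.  If y is negative, the rotated point is
    used; its middle coordinate is nonnegative because (0,2,2,-1) makes with (1,1,2,0) an
    angle of cosine sqrt(2/3), which is less than 45 degrees, and t^4 >= 4m says that the
    angle of the point itself with (1,1,2,0) is no larger. *)
Lemma nonneg_solution (m : nat) (t : nat) (x y z w : int) :
  x + y + 2 * z = (t ^ 2)%N%:Z -> m%:Z = x ^+ 2 + y ^+ 2 + z ^+ 2 + w ^+ 2 ->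
  (4 * m <= t ^ 4)%N -> thirds_representable m.
Proof.
wlog yx : x y / y <= x.
  move=> W; case: (lerP y x) => [yx|/ltW xy]; first exact: W.
  by move=> h1 h2; apply: (W y x) => //; [rewrite [y + x]addrC | rewrite [y ^+ 2 + _]addrC].
wlog w0 : w / 0 <= w.
  move=> W; case: (lerP 0 w) => [w0|/ltW w0]; first exact: W.
  by move=> h1 h2; apply: (W (- w)) => //; [lia | rewrite sqrrN].
move=> hL hm le4.
have L2 : 4 * (x ^+ 2 + y ^+ 2 + z ^+ 2 + w ^+ 2) <= (x + y + 2 * z) ^+ 2.
  by rewrite -hm hL; move: le4; rewrite (expnM t 2 2) -[((t ^ 2) ^ 2)%N]mulnn; lia.
have L0 : 0 <= x + y + 2 * z by rewrite hL.
have sq (u : int) : 0 <= u * u by rewrite -expr2 sqr_ge0.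
have x0 : 0 <= x.
  case: (lerP 0 x) => // xneg; have : 0 < (2 * z - (x + y + 2 * z)) * (2 * z + (x + y + 2 * z)).
    by apply: mulr_gt0; clear -L0 xneg yx; lia.
  by have := sq x; have := sq y; have := sq w; clear -L2; lia.
have z0 : 0 <= z.
  case: (lerP 0 z) => // zneg; have : 0 < (x + y - (x + y + 2 * z)) * (x + y + (x + y + 2 * z)).
    by apply: mulr_gt0; clear -L0 zneg; lia.
  by have := sq (x - y); have := sq z; have := sq w; clear -L2; lia.
have nat_of (u : int) : 0 <= u -> exists v : nat, u = v%:Z.
  by move=> u0; exists `|u|%N; lia.
have [x' xE] := nat_of _ x0.
have [y0|y0] := lerP 0 y.
  have [y' yE] := nat_of _ y0; have [z' zE] := nat_of _ z0; have [w' wE] := nat_of _ w0.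
  exists x', (3 * y')%N, (3 * z')%N, (3 * w')%N, t; subst x y z w.
  by split; [clear -hm | clear -hL]; lia.
have Z0 : 0 <= 2 * y + 2 * z - w.
  have I : 6 * (x ^+ 2 + y ^+ 2 + z ^+ 2 + w ^+ 2) =
    3 * (x + y + 2 * z) ^+ 2 - 4 * (x + y + 2 * z) * (2 * y + 2 * z - w)
     + 2 * (2 * y + 2 * z - w) ^+ 2 + (x - y - 2 * w) ^+ 2 + 2 * (x + y - z) ^+ 2 by ring.
  case: (lerP 0 (2 * y + 2 * z - w)) => // dneg.
  have : 0 <= (x + y + 2 * z) * (- (2 * y + 2 * z - w)) by apply: mulr_ge0; [|clear -dneg; lia].
  have := sq (2 * y + 2 * z - w); have := sq (x - y - 2 * w); have := sq (x + y - z).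
  have : 0 < (2 * y + 2 * z - w) * (2 * y + 2 * z - w) by rewrite nmulr_rgt0.
  have := sq (x + y + 2 * z).
  move: L2 I; move: (x ^+ 2 + _ + _ + _) (x + y + 2 * z) (2 * y + 2 * z - w).
  by move: (x - y - 2 * w) (x + y - z) => p q S L d; clear; lia.
have Y0 : 0 <= - y + 2 * z + 2 * w by clear -y0 z0 w0; lia.
have [Y YE] := nat_of _ Y0; have [Z ZE] := nat_of _ Z0.
have [W WE] := nat_of `|2 * y - z + 2 * w| (normr_ge0 _).
exists x', Y, Z, W, t; split; last by clear -hL YE ZE xE; lia.
have W2 : (W%:Z) ^+ 2 = (2 * y - z + 2 * w) ^+ 2 by rewrite -WE real_normK ?num_real.
have : 9 * m%:Z = 9 * x'%:Z ^+ 2 + Y%:Z ^+ 2 + Z%:Z ^+ 2 + W%:Z ^+ 2.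
  by rewrite W2 -YE -ZE -xE hm; ring.
by clear; lia.
Qed.

(** Powers of 4 are taken out first, since the ternary theorem excludes multiples of 4. *)
Lemma ternary_236 (n : nat) (i n' : nat) : n = (4 ^ i * n')%N ->
  (0 < n')%N -> ~~ (4 %| n')%N -> (n' %% 8 != 7)%N -> (n %% 3 != 1)%N ->
  exists B a w : int, n%:Z = 2 * B ^+ 2 + 3 * a ^+ 2 + 6 * w ^+ 2.
Proof.
move=> nE n0 n4 n7 n3.
have [|||x [y [z E]]] := @represented_by_A2 (3 * n'); [by lia | by lia | by lia |].
have [W [b E2]] := A2_diagonal y z; rewrite {}E2 in E.
apply: (@divide_out_3 _ (2 ^+ i * x) (2 ^+ i * W) (2 ^+ i * b)).
  rewrite nE PoszM (_ : (4 ^ i)%N%:Z = 2 ^+ i * 2 ^+ i).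
    have -> : 3 * (2 ^+ i * 2 ^+ i * n'%:Z) = 2 ^+ i * 2 ^+ i * (3 * n')%N%:Z by rewrite PoszM; ring.
    by rewrite E; ring.
  by rewrite -natz natrX -exprMn.
by move=> q; lia.
Qed.

Theorem representable_in_window (m s i n' : nat) :
  (6 * m = s ^ 4 + 4 ^ i * n')%N -> (4 * m <= s ^ 4)%N ->
  (0 < n')%N -> ~~ (4 %| n')%N -> (n' %% 8 != 7)%N -> thirds_representable m.
Proof.
move=> E le4 n0 n4 n7.
have s4 : (s ^ 4 = (s ^ 2) * (s ^ 2))%N by rewrite -expnD.
have n3 : ((4 ^ i * n') %% 3 != 1)%N.
  have : ((s ^ 4 + 4 ^ i * n') %% 3 = 0)%N by rewrite -E (_ : 6 * m = 2 * m * 3)%N ?modnMl //; lia.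
  rewrite -modnDm -(modnXm 4 3 s); have := ltn_pmod s (isT : 0 < 3)%N.
  by case: (s %% 3)%N => [|[|[|?]]] //= _; case: ((4 ^ i * n') %% 3)%N => [|[|[|?]]].
have [B [a [w E2]]] := ternary_236 erefl n0 n4 n7 n3.
have [x [y [z [hL hm]]]] : exists x y z : int, x + y + 2 * z = (s ^ 2)%N%:Z /\
    m%:Z = x ^+ 2 + y ^+ 2 + z ^+ 2 + w ^+ 2.
  apply: (@four_squares_on_plane _ _ B a); rewrite -E2; move: E; rewrite s4.
  by move: (4 ^ i * n')%N (s ^ 2)%N => N L; clear; lia.
exact: nonneg_solution hL hm le4.
Qed.

(** * Large values of m *)

(** Two consecutive integers of the same parity satisfy (s + 2)^4 <= (3/2) s^4 as soon as
    s >= 19. *)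
Lemma fourth_power_window (X r : nat) : (r <= 1)%N -> (100 * 534 <= X)%N ->
  exists k, let s := (2 * k + r)%N in (2 * X <= s ^ 4 <= 3 * X)%N.
Proof.
move=> r1 X0.
have [k /andP [k1 k2]] : exists k, ((2 * k + r) ^ 4 <= 3 * X < (2 * k.+1 + r) ^ 4)%N.
  have [k0] : exists k, (3 * X < (2 * k.+1 + r) ^ 4)%N.
    exists (3 * X)%N; apply: leq_trans (_ : (3 * X).+1 ^ 4 <= _)%N; last by rewrite leq_exp2r //; lia.
    by rewrite -[Y in (Y <= _)%N]expn1 leq_exp2l //; lia.
  elim: k0 => [|k IHk] lt; first by exists 0%N; rewrite lt andbT; case: r r1 {lt} => [|[|]] //; lia.
  by case: (leqP ((2 * k.+1 + r) ^ 4) (3 * X)) => le; [exists k.+1; rewrite le | apply: IHk].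
exists k => /=; rewrite k1 andbT.
have s19 : (19 <= 2 * k + r)%N.
  rewrite leqNgt; apply/negP => lt.
  have : ((2 * k.+1 + r) ^ 4 <= 20 ^ 4)%N by rewrite leq_exp2r //; lia.
  by rewrite (_ : 20 ^ 4 = 160 * 1000)%N //; lia.
move: k1 k2 s19; rewrite (_ : 2 * k.+1 + r = (2 * k + r) + 2)%N; last by lia.
move: (2 * k + r)%N => s k1 k2 s19.
have : (2 * (s + 2) ^ 4 <= 3 * s ^ 4)%N.
  have -> : (s = (s - 19) + 19)%N by lia.
  move: (s - 19)%N => u; clear.
  by rewrite !expnS !expn0; nia.
by lia.
Qed.

(** The parity of s is chosen so that 6m - s^4, freed of its factors 4, avoids 0 modulo 4 and
    7 modulo 8: s odd if 4 does not divide m; s = 2k if m = 4 modulo 8; s = 2k with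
    k odd or even according as j = 1 or 3 modulo 4 if m = 8j. *)
Theorem representable_large (m : nat) : ~~ (16 %| m)%N ->
  ((if 8 %| m then 100 * 4272 else 100 * 267) <= m)%N -> thirds_representable m.
Proof.
move=> m16 m0.
have even4 k : ((2 * k) ^ 4 = 16 * k ^ 4)%N by rewrite expnMn.
have odd4 k : exists q, ((2 * k + 1) ^ 4 = 16 * q + 1)%N.
  have [q qE] : exists q, (k * (3 * k + 1) = 2 * q)%N.
    exists ((k * (3 * k + 1)) %/ 2)%N; rewrite [RHS]mulnC divnK // dvdn2 oddM oddD oddM.
    by case: odd.
  exists (k ^ 4 + 2 * k ^ 3 + q)%N.
  have -> : ((2 * k + 1) ^ 4 = 16 * k ^ 4 + 32 * k ^ 3 + 8 * (k * (3 * k + 1)) + 1)%N by ring.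
  by rewrite qE; ring.
have [m4|m4] := boolP (4 %| m)%N; last first.
  have m0' : (100 * 267 <= m)%N by apply: leq_trans m0; case: ifP.
  have [//||k /= /andP [w1 w2]] := @fourth_power_window (2 * m) 1; first by lia.
  have [q qE] := odd4 k; rewrite qE in w1 w2.
  apply: (@representable_in_window m (2 * k + 1) 0 (6 * m - (16 * q + 1))); rewrite ?qE ?expn0; lia.
have [m8|m8] := boolP (8 %| m)%N; last first.
  rewrite (negbTE m8) in m0.
  have [//||k /= /andP [w1 w2]] := @fourth_power_window (2 * m) 0; first by lia.
  rewrite addn0 even4 in w1 w2.
  apply: (@representable_in_window m (2 * k) 1 (6 * (m %/ 4) - 4 * k ^ 4)); rewrite ?even4 ?expn1; lia.
rewrite m8 in m0.
have [j mE] : exists j, m = (8 * j)%N by exists (m %/ 8)%N; lia.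
have [j1|j3] : (j %% 4 = 1 \/ j %% 4 = 3)%N by lia.
  have [//||k /= /andP [w1 w2]] := @fourth_power_window j 1; first by lia.
  have [q qE] := odd4 k; rewrite qE in w1 w2.
  apply: (@representable_in_window m (2 * (2 * k + 1)) 2 (3 * j - (16 * q + 1))); rewrite ?even4 ?qE; lia.
have [//||k /= /andP [w1 w2]] := @fourth_power_window j 0; first by lia.
rewrite addn0 even4 in w1 w2.
apply: (@representable_in_window m (2 * (2 * k)) 2 (3 * j - (16 * k ^ 4))); rewrite ?even4; lia.
Qed.

(** * The remaining values of m *)

Section SmallCases.
Local Open Scope Z_scope.

Definition is_solution (m s x Y Z W : Z) : bool :=
  [&& 0 <=? x, 0 <=? Y, 0 <=? Z, 9 * m =? 9 * (x * x) + Y * Y + Z * Z + W * W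
    & 3 * x + Y + 2 * Z =? 3 * (s * s)].

Lemma is_solution_sound (m : nat) (s x Y Z W : Z) :
  is_solution (Z.of_nat m) s x Y Z W -> thirds_representable m.
Proof.
case/and5P => /Z.leb_le x0 /Z.leb_le Y0 /Z.leb_le Z0 /Z.eqb_eq E1 /Z.eqb_eq E2.
exists (Z.to_nat x), (Z.to_nat Y), (Z.to_nat Z), (Z.abs_nat W), (Z.abs_nat s).
rewrite -!mulnn; split.
  have : Z.of_nat (Z.abs_nat W) * Z.of_nat (Z.abs_nat W) = W * W by lia.
  by lia.
have : Z.of_nat (Z.abs_nat s) * Z.of_nat (Z.abs_nat s) = s * s by lia.
by lia.
Qed.

(** The point with given L = s^2, a, B and w, and its image under the rotation.  Rounding in
    the divisions is harmless, as the equations are checked afterwards. *)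
Definition test_point (m s a w B : Z) : bool :=
  let z := (s * s - B) / 3 in
  let x := (s * s - 2 * z + a) / 2 in
  let y := x - a in
  is_solution m s x (3 * y) (3 * z) (3 * w) ||
  is_solution m s x (2 * z + 2 * w - y) (2 * y + 2 * z - w) (2 * y - z + 2 * w).

Definition test_signs (m s a w B : Z) : bool :=
  [|| test_point m s a w B, test_point m s a w (- B),
      test_point m s a (- w) B, test_point m s a (- w) (- B),
      test_point m s (- a) w B, test_point m s (- a) w (- B),
      test_point m s (- a) (- w) B | test_point m s (- a) (- w) (- B)].

(** Runs through the solutions of 3 w^2 + B^2 = t by increasing w and decreasing B.  The
    conditionals, here and below, keep call-by-value evaluation from exploring both
    branches. *)
Fixpoint scan_wB (fuel : nat) (m s a t w B : Z) : bool :=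
  if fuel is k.+1 then
    if B <? 0 then false else
    match 3 * (w * w) + B * B ?= t with
    | Eq => if test_signs m s a w B then true else scan_wB k m s a t (w + 1) B
    | Lt => scan_wB k m s a t (w + 1) B
    | Gt => scan_wB k m s a t w (B - 1)
    end
  else false.

(** Large a come first: the points with x and y both negative tend to have a
    small a.  A value t of
    3 w^2 + B^2 is never 2 modulo 3 or 4. *)
Fixpoint scan_a (fuel : nat) (m s n a : Z) : bool :=
  if fuel is k.+1 then
    if a <? 0 then false else
    let t := (n - 3 * (a * a)) / 2 in
    if (if t mod 4 =? 2 then false else if t mod 3 =? 2 then false
        else scan_wB 3000 m s a t 0 (Z.sqrt t))
    then true else scan_a k m s n (a - 2)
  else false.

Fixpoint remove_fours (fuel : nat) (n : Z) : Z :=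
  if fuel is k.+1 then if n mod 4 =? 0 then remove_fours k (n / 4) else n else n.

Definition admissible (n : Z) : bool :=
  let n' := remove_fours 12 n in
  [&& 0 <? n, ~~ (n' mod 4 =? 0) & ~~ (n' mod 8 =? 7)].

Fixpoint search (fuel : nat) (m s : Z) : bool :=
  if fuel is k.+1 then
    let n := 6 * m - s * s * (s * s) in
    if (if (n =? 0) || admissible n then
          let a := Z.sqrt (n / 3) in scan_a 600 m s n (a - (a - s) mod 2)
        else false)
    then true else search k m (s - 1)
  else false.

Fixpoint in_window (fuel : nat) (m s : Z) : bool :=
  if fuel is k.+1 then
    let s4 := s * s * (s * s) in
    if s4 <? 4 * m then false else
    if admissible (6 * m - s4) then true else in_window k m (s - 1)
  else false.

(** Most m already have an s in the window to which the general theorem applies; the others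
    need an explicit solution. *)
Definition check (m : Z) : bool :=
  let s := Z.sqrt (Z.sqrt (6 * m)) in
  if in_window 6 m s then true else search 60 m s.

Fixpoint all_below (f : Z -> bool) (fuel : nat) (i : Z) : bool :=
  if fuel is k.+1 then if f i then all_below f k (i + 1) else false else true.

#[local] Arguments Z.mul : simpl never.

Lemma scan_wB_sound (m : nat) s a t fuel w B :
  scan_wB fuel (Z.of_nat m) s a t w B -> thirds_representable m.
Proof.
have signs w' B' : test_signs (Z.of_nat m) s a w' B' -> thirds_representable m.
  have point a' w'' B'' : test_point (Z.of_nat m) s a' w'' B'' -> thirds_representable m.
    by case/orP; apply: is_solution_sound.
  by case/or4P; [| | | case/or4P; [| | | case/orP]]; apply: point.
elim: fuel w B => [|k IHk] w B //=; case: ifP => // _; case: Z.compare => //.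
- by case: ifP => [/signs //|_]; apply: IHk.
- exact: IHk.
- exact: IHk.
Qed.

#[local] Arguments scan_wB : simpl never.

Lemma scan_a_sound (m : nat) s n fuel a :
  scan_a fuel (Z.of_nat m) s n a -> thirds_representable m.
Proof.
elim: fuel a => [|k IHk] a //=; case: ifP => // _.
case: ifP => [|_]; last exact: IHk.
by case: ifP => // _; case: ifP => // _ /scan_wB_sound.
Qed.

#[local] Arguments scan_a : simpl never.
#[local] Arguments admissible : simpl never.

Lemma search_sound (m : nat) fuel s : search fuel (Z.of_nat m) s -> thirds_representable m.
Proof.
elim: fuel s => [|k IHk] s //=.
by case: ifP => [|_]; [case: ifP => // _ /scan_a_sound | apply: IHk].
Qed.

Lemma of_nat_modn (n d : nat) : (0 < d)%N ->
  Z.of_nat n mod Z.of_nat d = Z.of_nat (n %% d)%N.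
Proof.
move=> d0; symmetry; apply: (Z.mod_unique_pos _ _ (Z.of_nat (n %/ d)%N)).
  by have := ltn_pmod n d0; lia.
by have := divn_eq n d; nia.
Qed.

Lemma remove_foursP fuel (n : nat) : (0 < n)%N -> exists i n' : nat,
  [/\ n = (4 ^ i * n')%N, (0 < n')%N & remove_fours fuel (Z.of_nat n) = Z.of_nat n'].
Proof.
elim: fuel n => [|k IHk] n n0; first by exists 0%N, n; rewrite expn0 mul1n.
rewrite /=; rewrite (of_nat_modn n (isT : 0 < 4)%N).
case: ifP => [/Z.eqb_eq n4|_]; last by exists 0%N, n; rewrite expn0 mul1n.
have [q nE] : exists q, n = (4 * q)%N by exists (n %/ 4)%N; lia.
have -> : Z.of_nat n / 4 = Z.of_nat q.
  by rewrite (_ : Z.of_nat n = Z.of_nat q * 4); [exact: Z.div_mul | lia].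
have [|i [n' [qE n'0 ->]]] := IHk q; first by lia.
by exists i.+1, n'; rewrite nE qE expnS mulnA.
Qed.

#[local] Arguments remove_fours : simpl never.

Lemma in_window_sound (m : nat) fuel s :
  in_window fuel (Z.of_nat m) s -> thirds_representable m.
Proof.
elim: fuel s => [|k IHk] s //=; case: ifP => // /Z.ltb_ge le4.
case: ifP => [|_]; last exact: IHk.
case/and3P => /Z.ltb_lt n0 n4 n8 _.
pose r := Z.abs_nat s.
have rE : Z.of_nat (r ^ 4)%N = s * s * (s * s).
  rewrite !expnS expn0 muln1.
  have : Z.of_nat r * Z.of_nat r = s * s by lia.
  by lia.
rewrite -rE in le4 n0 n4 n8.
move: n4 n8; have -> : 6 * Z.of_nat m - Z.of_nat (r ^ 4) = Z.of_nat (6 * m - r ^ 4) by lia.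
have [|i [n' [E n'0 ->]]] := @remove_foursP 12 (6 * m - r ^ 4); first by lia.
rewrite (of_nat_modn n' (isT : 0 < 4)%N) (of_nat_modn n' (isT : 0 < 8)%N).
by move=> n4 n8; apply: (@representable_in_window m r i n') => //; lia.
Qed.

Lemma check_sound (m : nat) : check (Z.of_nat m) -> thirds_representable m.
Proof. by rewrite /check; case: ifP => [/in_window_sound //|_ /search_sound]. Qed.

Lemma all_belowP f fuel i : all_below f fuel i ->
  forall k : nat, (k < fuel)%N -> f (i + Z.of_nat k).
Proof.
elim: fuel i => [|n IHn] i //=; case: ifP => // fi /IHn all_f [|k] kn.
  by rewrite Z.add_0_r.
by rewrite (_ : i + _ = i + 1 + Z.of_nat k); [apply: all_f | lia].
Qed.

Lemma small_cases :
  all_below (fun m => if m mod 8 =? 0 then true else check m) (100 * 267) 0 &&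
  all_below (fun j => if j mod 2 =? 0 then true else check (8 * j)) (100 * 534) 0.
Proof. by vm_compute. Qed.

Lemma representable_small (m : nat) : ~~ (16 %| m)%N ->
  (m < (if 8 %| m then 100 * 4272 else 100 * 267))%N -> thirds_representable m.
Proof.
have /andP [small1 small2] := small_cases.
move=> m16; case: ifP => m8 lt_m.
  have [j jE] : exists j, m = (8 * j)%N by exists (m %/ 8)%N; lia.
  have := all_belowP small2 (k := j).
  rewrite Z.add_0_l (of_nat_modn j (isT : 0 < 2)%N); case: ifP => [/Z.eqb_eq|_]; first by lia.
  rewrite (_ : 8 * Z.of_nat j = Z.of_nat m); last by lia.
  by move=> W; apply: check_sound; apply: W; lia.
have := all_belowP small1 (k := m) lt_m.
rewrite Z.add_0_l (of_nat_modn m (isT : 0 < 8)%N).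
by case: ifP => [/Z.eqb_eq|_]; [lia | apply: check_sound].
Qed.

End SmallCases.

Theorem thirds_representable_all (m : nat) : thirds_representable m.
Proof.
elim/ltn_ind: m => m IHm.
have [/dvdnP [k mE]|m16] := boolP (16 %| m)%N.
  have [->|m0] := posnP m; first by exists 0%N, 0%N, 0%N, 0%N, 0%N.
  have [|x [y [z [w [t [E1 E2]]]]]] := IHm k; first by lia.
  exists (4 * x)%N, (4 * y)%N, (4 * z)%N, (4 * w)%N, (2 * t)%N; rewrite mE !expnMn.
  by split; lia.
case: (leqP (if 8 %| m then 100 * 4272 else 100 * 267)%N m) => le_m.
  exact: representable_large.
exact: representable_small.
Qed.

Theorem theorem1p5 : forall m : nat, exists (x : nat) (y z w : rat),
  [/\ in_nat_thirds y, in_nat_thirds z, in_nat_thirds w,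
      m%:R = x%:R ^+ 2 + y ^+ 2 + z ^+ 2 + w ^+ 2 :> rat
    & is_int_square (x%:R + y + 2%:R * z)].
Proof.
move=> m; have [x [y [z [w [t [E1 E2]]]]]] := thirds_representable_all m.
exists x, (y%:R / 3%:R), (z%:R / 3%:R), (w%:R / 3%:R); split; try by eexists.
  have /(congr1 (fun n => n%:R : rat)) := E1.
  rewrite !(natrD, natrM, natrX) => E.
  have -> : m%:R = 9%:R * m%:R / 9%:R :> rat by field.
  by rewrite E; field.
exists t%:Z; rewrite rmorphXn /=.
have /(congr1 (fun n => n%:R : rat)) := E2.
rewrite !(natrD, natrM, natrX) => E.
have -> : (t%:Z)%:~R ^+ 2 = 3%:R * t%:R ^+ 2 / 3%:R :> rat by rewrite -[_%:~R]/(t%:R); field.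
by rewrite -E; field.
Qed.
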